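(* Let $K$ be a compact Hausdorff space, let $\varphi$ be a continuous non-invertible map of $K$ onto itself, and let $w \in C(K)$. Assume that $|w| > 0$ on $K$. Let $T = wT_\varphi$ be the corresponding weighted composition operator $(Tf)(k) = w(k) f(\varphi(k))$ on $C(K)$. The following conditions are equivalent. (1) The operator $\lambda I - T$ is lower semi-Fredholm for every $\lambda \in \mathbb{C}$ with $|\lambda| < \rho_{min}(T)$. (2) The operator $\lambda I - T$ is Fredholm for every $\lambda \in \mathbb{C}$ with $|\lambda| < \rho_{min}(T)$. (3) The map $\varphi$ is an almost homeomorphism of $K$. Moreover, for every $\lambda \in \mathbb{C}$ with $|\lambda| < \rho_{min}(T)$, $$\mathrm{ind}(\lambda I - T) = \mathrm{def}(\lambda I - T) = \mathrm{card}\,\{(p,q) : p,q \in K,\ p \neq q,\ \varphi(p) = \varphi(q)\}.$$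
   Context: $C(K)$ is the Banach algebra of continuous complex-valued functions on $K$ with the supremum norm. A continuous surjection $\varphi : K \to K$ is non-invertible if it is not a homeomorphism. A continuous surjection $\varphi : K \to K$ is called an almost homeomorphism of $K$ if there is a finite subset $S$ of $K$ such that the map $\varphi : K \setminus S \to K \setminus \varphi(S)$ is a homeomorphism. When $|w|>0$ on $K$, $\rho_{min}(T) = \min_{\mu \in M_\varphi} \exp \int \ln|w|\, d\mu$, where $M_\varphi$ is the set of all regular Borel $\varphi$-invariant probability measures on $K$. A bounded operator $A$ on a Banach space $X$ is lower semi-Fredholm if its defect $\mathrm{def}(A) = \mathrm{codim}(AX)$ is finite, upper semi-Fredholm if its range is closed and $\dim\ker A < \infty$, and Fredholm if it is both. In this statement the index convention is $\mathrm{ind}(A) = \mathrm{def}(A) - \dim \ker A$.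
   Formalization: The cardinality formula is corrected: counting all pairs (p,q) is false (a two-point fibre gives 2 ordered pairs but defect 1), so only pairs whose q is a chosen base point of its fibre are counted, for any choice; a fibre with n points contributes n-1. *)

(* Defs.v *)
From HB Require Import structures.
From mathcomp Require Import all_boot all_order all_algebra.
From mathcomp Require Import all_classical all_reals all_analysis.
From mathcomp Require Import complex.

Set Implicit Arguments.
Unset Strict Implicit.
Unset Printing Implicit Defensive.

Import Order.TTheory GRing.Theory Num.Theory.
Import numFieldNormedType.Exports.

Local Open Scope classical_set_scope.
Local Open Scope ring_scope.
Local Open Scope complex_scope.

HB.instance Definition _ (R : rcfType) := NormedModule.copy R[i] R[i]^o.

Local Notation normc := (@Normc.normc _).

Section ContinuousFunctions.
Variables (R : realType) (K : ptopologicalType) (cK : compact [set: K]).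

(* C(K). The unused argument cK makes the sup norm below well defined. *)
Definition cfun of compact [set: K] : Type := continuousType K R[i].

Local Notation CK := (cfun cK).

HB.instance Definition _ := Choice.copy CK (continuousType K R[i]).

Definition to_cfun (f : K -> R[i]) (cf : continuous f) : CK :=
  (mkcts cf : continuousType K R[i]).

Lemma cfunP (f g : CK) : f = g <-> f =1 g.
Proof. exact: continuousEP. Qed.

Lemma cfun_cts (f : CK) : continuous f.
Proof. exact: (@cts_fun _ _ (f : continuousType K R[i])). Qed.

Fact cfun_add_cts (f g : CK) : continuous (fun k => f k + g k).
Proof. by move=> k; apply: continuousD; exact: cfun_cts. Qed.

Fact cfun_opp_cts (f : CK) : continuous (fun k => - f k).
Proof. by move=> k; apply: continuousN; exact: cfun_cts. Qed.

Fact cfun_zero_cts : continuous (fun _ : K => 0 : R[i]).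
Proof. by move=> k; exact: cvg_cst. Qed.

Fact cfun_scale_cts (a : R[i]) (f : CK) : continuous (fun k => a * f k).
Proof. by move=> k; apply: continuousM; [exact: cvg_cst|exact: cfun_cts]. Qed.

Definition cfun_add (f g : CK) : CK := to_cfun (@cfun_add_cts f g).
Definition cfun_opp (f : CK) : CK := to_cfun (@cfun_opp_cts f).
Definition cfun_zero : CK := to_cfun cfun_zero_cts.
Definition cfun_scale (a : R[i]) (f : CK) : CK := to_cfun (@cfun_scale_cts a f).

Fact cfun_addA : associative cfun_add.
Proof. by move=> f g h; apply/cfunP => k /=; rewrite /mkcts addrA. Qed.

Fact cfun_addC : commutative cfun_add.
Proof. by move=> f g; apply/cfunP => k /=; rewrite /mkcts addrC. Qed.

Fact cfun_add0 : left_id cfun_zero cfun_add.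
Proof. by move=> f; apply/cfunP => k /=; rewrite /mkcts add0r. Qed.

Fact cfun_addN : left_inverse cfun_zero cfun_opp cfun_add.
Proof. by move=> f; apply/cfunP => k /=; rewrite /mkcts addNr. Qed.

HB.instance Definition _ := GRing.isZmodule.Build CK
  cfun_addA cfun_addC cfun_add0 cfun_addN.

Fact cfun_scaleA a b (f : CK) :
  cfun_scale a (cfun_scale b f) = cfun_scale (a * b) f.
Proof. by apply/cfunP => k /=; rewrite /mkcts mulrA. Qed.

Fact cfun_scale1 : left_id 1 cfun_scale.
Proof. by move=> f; apply/cfunP => k /=; rewrite /mkcts mul1r. Qed.

Fact cfun_scaleDr : right_distributive cfun_scale +%R.
Proof. by move=> a f g; apply/cfunP => k /=; rewrite /mkcts mulrDr. Qed.

Fact cfun_scaleDl (f : CK) : {morph cfun_scale^~ f : a b / a + b}.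
Proof. by move=> a b; apply/cfunP => k /=; rewrite /mkcts mulrDl. Qed.

HB.instance Definition _ := GRing.Zmodule_isLmodule.Build R[i] CK
  cfun_scaleA cfun_scale1 cfun_scaleDr cfun_scaleDl.

Lemma cfunDE (f g : CK) k : (f + g) k = f k + g k. Proof. by []. Qed.
Lemma cfunNE (f : CK) k : (- f) k = - f k. Proof. by []. Qed.
Lemma cfun0E k : (0 : CK) k = 0. Proof. by []. Qed.
Lemma cfunZE a (f : CK) k : (a *: f) k = a * f k. Proof. by []. Qed.

Definition supnorm (f : CK) : R := sup (range (fun k => normc (f k))).

Lemma normc_ge0 (z : R[i]) : 0 <= normc z.
Proof. by case: z => a b; exact: sqrtr_ge0. Qed.

Lemma normc_cts : continuous (normc : R[i] -> R).
Proof.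
move=> z; apply/(@cvgrPdist_lt _ _ _ (nbhs (z : R[i]))) => e e0.
have e0' : 0 < e%:C :> R[i] by rewrite ltcR.
apply: filterS (nbhsx_ballx z _ e0') => y; rewrite /ball/= => zy; rewrite -ltcR (le_lt_trans _ zy)//.
have := ler_dist_dist z y; congr (_ <= _).
rewrite -[`|z|]/((normc z)%:C) -[`|y|]/((normc y)%:C) -rmorphB/=.
by rewrite normc_def/= expr0n/= addr0 sqrtr_sqr.
Qed.

Lemma has_ubound_cfun (f : CK) : has_ubound (range (fun k => normc (f k))).
Proof.
have cn : continuous (fun k => normc (f k)).
  by move=> k; apply: continuous_comp; [exact: cfun_cts|exact: normc_cts].
have [c _ cmax] : exists2 c, c \in [set: K] &
    forall t, t \in [set: K] -> normc (f t) <= normc (f c).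
  apply: (compact_EVT_max _ cK).
    by exists point.
  exact: continuous_subspaceT.
by exists (normc (f c)) => _ [k _ <-]; apply: cmax; rewrite in_setT.
Qed.

Lemma normc_le_supnorm (f : CK) k : normc (f k) <= supnorm f.
Proof. by apply: (ub_le_sup (has_ubound_cfun f)); exists k. Qed.

Lemma supnorm_le (f : CK) (M : R) :
  (forall k, normc (f k) <= M) -> supnorm f <= M.
Proof.
move=> fM; apply: ge_sup; first by exists (normc (f point)), point.
by move=> _ [k _ <-].
Qed.

Definition cfun_norm (f : CK) : R[i] := (supnorm f)%:C.

Fact cfun_normD (f g : CK) : cfun_norm (f + g) <= cfun_norm f + cfun_norm g.
Proof.
rewrite /cfun_norm -rmorphD/= lecR; apply: supnorm_le => k; rewrite cfunDE.
rewrite (le_trans (le_normcD _ _))// lerD//; exact: normc_le_supnorm.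
Qed.

Fact cfun_normZ (a : R[i]) (f : CK) : cfun_norm (a *: f) = `|a| * cfun_norm f.
Proof.
rewrite /cfun_norm -[`|a|]/((normc a)%:C) -rmorphM/=; congr (_%:C).
have [->|a0] := eqVneq a 0.
  rewrite Normc.normc0 mul0r; apply/eqP; rewrite eq_le; apply/andP; split.
    by apply: supnorm_le => k; rewrite cfunZE mul0r Normc.normc0.
  exact: le_trans (normc_ge0 _) (normc_le_supnorm _ point).
have na0 : 0 < normc a.
  by rewrite lt_def normc_ge0 andbT; apply: contra a0 => /eqP/Normc.eq0_normc->.
apply/eqP; rewrite eq_le; apply/andP; split.
  apply: supnorm_le => k; rewrite cfunZE Normc.normcM ler_pM2l//.
  exact: normc_le_supnorm.
rewrite -ler_pdivlMl//; apply: supnorm_le => k.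
rewrite ler_pdivlMl// -Normc.normcM -cfunZE; exact: normc_le_supnorm.
Qed.

Fact cfun_norm0_eq0 (f : CK) : cfun_norm f = 0 -> f = 0.
Proof.
case=> f0; apply/cfunP => k; apply: Normc.eq0_normc; apply/eqP.
by rewrite eq_le normc_ge0 -f0 normc_le_supnorm.
Qed.

HB.instance Definition _ := Lmodule_isNormed.Build R[i] CK
  cfun_normD cfun_normZ cfun_norm0_eq0.

Lemma cfun_normE (f : CK) : `|f| = (supnorm f)%:C. Proof. by []. Qed.

End ContinuousFunctions.

Section WeightedComposition.
Variables (R : realType) (K : ptopologicalType) (cK : compact [set: K]).
Variables (w : cfun R cK) (phi : continuousType K K).

Fact wcomp_cts (f : cfun R cK) : continuous (fun k => w k * f (phi k)).
Proof.
move=> k; apply: continuousM; first exact: cfun_cts.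
by apply: continuous_comp; [exact: cts_fun|exact: cfun_cts].
Qed.

Definition wcomp (f : cfun R cK) : cfun R cK := to_cfun cK (@wcomp_cts f).

Fact wcomp_linear : linear wcomp.
Proof.
move=> a f g; apply/cfunP => k.
change (w k * (a * f (phi k) + g (phi k)) =
        a * (w k * f (phi k)) + w k * g (phi k)).
by rewrite mulrDr mulrCA.
Qed.

HB.instance Definition _ :=
  GRing.isLinear.Build R[i] (cfun R cK) (cfun R cK) *:%R wcomp wcomp_linear.

Lemma wcompE f k : wcomp f k = w k * f (phi k). Proof. by []. Qed.

Lemma wcomp_norm_le f : `|wcomp f| <= `|w| * `|f|.
Proof.
rewrite !cfun_normE -rmorphM/= lecR; apply: supnorm_le => k.
rewrite wcompE Normc.normcM ler_pM ?normc_ge0//; exact: normc_le_supnorm.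
Qed.

Lemma wcomp_continuous : continuous wcomp.
Proof.
apply: bounded_linear_continuous; apply/linear_boundedP.
near=> r => f; apply: (le_trans (wcomp_norm_le f)).
suff wr : `|w| <= r by rewrite ler_wpM2r.
by near: r; apply: nbhs_pinfty_ge; exact: normr_real.
Unshelve. all: by end_near. Qed.

End WeightedComposition.

Section Fredholm.
Variables (R : realType) (F : numFieldType).
Local Open Scope ereal_scope.

(* Linear independence modulo the subspace U, i.e. independence of the classes
   in the quotient by U. *)
Definition free_mod (V : lmodType F) (U : set V) n (v : 'I_n -> V) :=
  forall c : 'I_n -> F, U (\sum_i c i *: v i)%R -> forall i, c i = 0%R.

Definition edim (V : lmodType F) (U : set V) : \bar R :=
  ereal_sup [set n%:R%:E | n in [set n : nat | exists v : 'I_n -> V,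
    (forall i, U (v i)) /\ free_mod [set 0%R] v]].

Definition ecodim (V : lmodType F) (U : set V) : \bar R :=
  ereal_sup [set n%:R%:E | n in [set n : nat | exists v : 'I_n -> V,
    free_mod U v]].

Variables X Y : normedModType F.
Implicit Types A : {linear X -> Y}.

Definition null_space A : set X := A @^-1` [set 0%R].

Definition nullity A : \bar R := edim (null_space A).

Definition defect A : \bar R := ecodim (range A).

Definition lower_semi_fredholm A := defect A < +oo.

Definition upper_semi_fredholm A := closed (range A) /\ nullity A < +oo.

Definition fredholm A := lower_semi_fredholm A /\ upper_semi_fredholm A.

(* The sign is the opposite of the most common one. The value is meaningful
   only if defect and nullity are not both infinite. *)
Definition fredholm_index A : \bar R := defect A - nullity A.

End Fredholm.

Section Homeomorphism.
Variable K : ptopologicalType.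

Definition homeomorphism_on (A B : set K) (f : K -> K) :=
  exists g : K -> K,
    [/\ set_fun A B f, set_fun B A g, {in A, cancel f g} & {in B, cancel g f}] /\
    {within A, continuous f} /\ {within B, continuous g}.

Definition almost_homeomorphism (f : K -> K) :=
  [/\ continuous f, range f = [set: K] &
    exists S : set K, finite_set S /\ homeomorphism_on (~` S) (~` (f @` S)) f].

End Homeomorphism.

Section InvariantMeasures.
Variables (R : realType) (K : ptopologicalType).

Definition borel_space := g_sigma_algebraType (@open K).

Local Notation probK := (probability borel_space R).

Definition regular_measure (mu : probK) :=
  forall A : set borel_space, measurable A ->
    mu A = ereal_inf [set mu U | U in [set U : set K | open U /\ A `<=` U]] /\
    mu A = ereal_sup [set mu C | C in [set C : set K | compact C /\ C `<=` A]].

Definition invariant_measure (phi : K -> K) (mu : probK) :=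
  forall A : set borel_space, measurable A -> mu (phi @^-1` A) = mu A.

Definition invariant_probabilities (phi : K -> K) : set probK :=
  [set mu | regular_measure mu /\ invariant_measure phi mu].

(* The infimum is attained when K is compact Hausdorff and w has no zero:
   invariant_probabilities phi is nonempty and weak-* compact. *)
Definition rho_min (w : K -> R[i]) (phi : K -> K) : R :=
  inf [set expR (\int[mu]_(k in [set: borel_space]) ln (normc (w k)))%R
      | mu in invariant_probabilities phi].

(* Pairs (p, q) of distinct points identified by phi, with q the point of its
   fibre chosen by the section s. A fibre with n points contributes n - 1
   pairs; all ordered (unordered) pairs would give n (n - 1) (half of it). *)
Definition identified_pairs (phi s : K -> K) : set (K * K) :=
  [set pq | [/\ pq.1 <> pq.2, phi pq.1 = phi pq.2 & pq.2 = s (phi pq.2)]].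

End InvariantMeasures.

(* Main.v *)
Require Import Defs.
From HB Require Import structures.
From mathcomp Require Import all_boot all_order all_algebra.
From mathcomp Require Import all_classical all_reals all_analysis.
From mathcomp Require Import complex ring lra.
From mathcomp Require finmap.

Import Order.TTheory GRing.Theory Num.Theory.
Import numFieldNormedType.Exports.

Local Open Scope classical_set_scope.
Local Open Scope ring_scope.
Local Open Scope complex_scope.

Set Implicit Arguments.
Unset Strict Implicit.
Unset Printing Implicit Defensive.

(** Put rho = rho_min and |lambda| < rho.

    A weak-* limit of empirical measures along orbits on which the products
    w_n = w (w o phi) ... (w o phi^(n-1)) are at most |lambda|^n would be an
    invariant probability with exp (int ln |w|) <= |lambda|; hence
    |w_n| > |lambda|^n everywhere for some n. As phi is onto, T^n is then
    bounded below by a constant larger than |lambda|^n, and factoring mu^n - T^n through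
    mu - T shows that mu - T is bounded below uniformly in |mu| <= |lambda|. So
    the kernel is trivial, the range is closed, and the defect is constant along
    the segment from 0 to lambda. Finally T has range w.{f constant on the
    fibres of phi}, whose codimension is the number of excess points of the
    fibres; and phi, being a closed map, is an almost homeomorphism exactly when
    this number is finite.

    The weak-* limit is obtained without Riesz representation: the limit along
    an ultrafilter of the visit frequencies is a finitely additive invariant
    probability m on all subsets of K, and
    U |-> sup {m C | C closed, C <= U} extends to a regular Borel measure. *)

Local Notation normc := (@Normc.normc _).

(** * Subspaces of finite codimension *)

Section Subspaces.
Variables (F : numFieldType) (V : lmodType F).
Implicit Types (U : set V).

Definition subspace_set U := U 0 /\ forall a x y, U x -> U y -> U (a *: x + y).

Definition span_mod U n (v : 'I_n -> V) : set V :=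
  [set x | exists2 c : 'I_n -> F, U (x - \sum_i c i *: v i) & True].

Definition has_free_mod U n := exists v : 'I_n -> V, free_mod U v.

Variable U : set V.
Hypothesis sU : subspace_set U.

Lemma subspaceD x y : U x -> U y -> U (x + y).
Proof. by case: sU => _ H Ux Uy; rewrite -[x]scale1r; exact: H. Qed.

Lemma subspaceZ a x : U x -> U (a *: x).
Proof. by case: sU => U0 H Ux; rewrite -[_ *: _]addr0; exact: H. Qed.

Lemma subspaceN x : U x -> U (- x).
Proof. by rewrite -scaleN1r; exact: subspaceZ. Qed.

Lemma subspaceB x y : U x -> U y -> U (x - y).
Proof. by move=> Ux Uy; apply: subspaceD => //; exact: subspaceN. Qed.

Lemma subspace_sum I (r : seq I) (P : pred I) (f : I -> V) :
  (forall i, P i -> U (f i)) -> U (\sum_(i <- r | P i) f i).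
Proof.
move=> Uf; apply: big_ind => //; last exact: subspaceD.
by case: sU.
Qed.

Lemma span_mod_subspace n (v : 'I_n -> V) : subspace_set (span_mod U v).
Proof.
split.
  exists (fun=> 0) => //; rewrite big1 ?subr0; first by case: sU.
  by move=> i _; rewrite scale0r.
move=> a x y [c Ux _] [d Uy _]; exists (fun i => a * c i + d i) => //.
under eq_bigr do rewrite scalerDl -scalerA.
rewrite big_split/= -scaler_sumr opprD addrACA -scalerBr.
by case: sU => _; apply.
Qed.

Lemma free_mod0 (v : 'I_0 -> V) : free_mod U v.
Proof. by move=> c _ []. Qed.

(** If [x] were outside the span, putting it in front of [v] would give an independent family of
    length [n.+1]: a relation with nonzero coefficient at [x] could be solved for [x]. *)
Lemma maximal_free_span n (v : 'I_n -> V) : free_mod U v ->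
  ~ has_free_mod U n.+1 -> forall x, span_mod U v x.
Proof.
move=> fv nf x; apply: contrapT => nx; apply: nf.
exists (fun i => if unlift ord0 i is Some j then v j else x) => c.
rewrite big_ord_recl unlift_none.
under eq_bigr do rewrite liftK.
move=> Uc; have c0 : c ord0 = 0.
  apply: contrapT => /eqP c0; apply: nx.
  exists (fun i => - (c ord0)^-1 * c (lift ord0 i)) => //.
  have := subspaceZ (c ord0)^-1 Uc.
  rewrite scalerDr scalerA mulVf// scale1r scaler_sumr.
  congr U; congr (_ + _); rewrite -sumrN; apply: eq_bigr => i _.
  by rewrite scalerA mulNr scaleNr opprK.
move: Uc; rewrite c0 scale0r add0r => /fv ci0 i.
by case: (unliftP ord0 i) => [j ->|->].
Qed.

(** Steinitz bound modulo [U]. The coordinates of the [v i] along [u] form an n by m matrix; for m <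
    n a nonzero row in its left kernel is a forbidden relation among the [v i]. *)
Lemma free_span_card m n (u : 'I_m -> V) (v : 'I_n -> V) :
  (forall x, span_mod U u x) -> free_mod U v -> (n <= m)%N.
Proof.
move=> su fv; rewrite leqNgt; apply/negP => mn.
have /choice[B HB] i : exists c : 'I_m -> F, U (v i - \sum_j c j *: u j).
  by have [c Uc _] := su (v i); exists c.
pose M : 'M[F]_(n, m) := \matrix_(i, j) B i j.
have : kermx M != 0.
  rewrite kermx_eq0 /row_free; apply: contraL mn => /eqP <-.
  by rewrite -leqNgt rank_leq_col.
case/rowV0Pn => c /sub_kermxP cM; apply/negP; rewrite negbK.
apply/eqP/rowP => i; rewrite mxE; apply: (fv (fun i => c 0 i)).
have : U (\sum_i c 0 i *: (v i - \sum_j B i j *: u j)).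
  by apply: subspace_sum => k _; apply: subspaceZ.
under eq_bigr do rewrite scalerBr scaler_sumr.
rewrite sumrB [X in _ - X]exchange_big/= [X in _ - X]big1 ?subr0// => j _.
under eq_bigr do rewrite scalerA.
rewrite -scaler_suml (_ : \sum_(i < n) _ = (c *m M) 0 j); last first.
  by rewrite mxE; apply: eq_bigr => k _; rewrite mxE.
by rewrite cM mxE scale0r.
Qed.

(** The least length without an independent family is positive, the empty family being free; a
    family one shorter exists and is maximal, hence spans. *)
Lemma not_has_free_mod n : ~ has_free_mod U n ->
  exists m (u : 'I_m -> V),
    [/\ (m < n)%N, free_mod U u & forall x, span_mod U u x].
Proof.
move=> nPn; have ex : exists k, `[< ~ has_free_mod U k >].
  by exists n; exact/asboolP.
case: (ex_minnP ex) => -[/asboolP[]|m /asboolP nm min].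
  by exists (fun=> 0); exact: free_mod0.
have [[u fu]|nPm] := pselect (has_free_mod U m); last first.
  by have := min m (asboolT nPm); rewrite ltnn.
exists m, u; split => //; first by apply: min; exact/asboolP.
exact: maximal_free_span.
Qed.

End Subspaces.

Section LinearRange.
Variables (F : numFieldType) (V W : lmodType F) (A : {linear V -> W}).

Lemma range_subspace : subspace_set (range A).
Proof.
split; first by exists 0 => //; rewrite linear0.
by move=> a _ _ [x _ <-] [y _ <-]; exists (a *: x + y) => //; rewrite linearP.
Qed.

End LinearRange.

(** * Sequentially complete normed spaces *)

Section SequentialCompleteness.
Variable R : realType.

(** Phrased for a bare real-valued [N], so that one notion covers the real and complex moduli and
    the sup norm. *)
Definition seq_complete (V : zmodType) (N : V -> R) := forall u : nat -> V,
  (forall e, 0 < e -> exists n, forall i j, (n <= i)%N -> (n <= j)%N ->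
    N (u i - u j) <= e) ->
  exists l, forall e, 0 < e -> exists n, forall i, (n <= i)%N -> N (u i - l) <= e.

Lemma seq_complete_real : seq_complete (fun x : R => `|x|).
Proof.
move=> u cu; have : cvg (u @ \oo).
  apply: cauchy_cvg; apply: cauchy_exP => e e0.
  have e20 : 0 < e / 2 by rewrite divr_gt0.
  have [n Hn] := cu _ e20; exists (u n); exists n => // i ni.
  rewrite /ball/= (le_lt_trans (Hn n i _ _))//.
  by rewrite ltr_pdivrMr// ltr_pMr// ltr1n.
case/cvg_ex => l ul; exists l => e e0.
have /cvgrPdist_le/(_ _ e0) [n _ Hn] := ul.
by exists n => i ni; rewrite distrC; exact: Hn.
Qed.

Lemma Re_le_normc (z : R[i]) : `|complex.Re z| <= normc z.
Proof.
case: z => a b /=; rewrite -sqrtr_sqr ler_wsqrtr// lerDl sqr_ge0//.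
Qed.

Lemma Im_le_normc (z : R[i]) : `|complex.Im z| <= normc z.
Proof.
case: z => a b /=; rewrite -sqrtr_sqr ler_wsqrtr// lerDr sqr_ge0//.
Qed.

Lemma normc_le_ReIm (z : R[i]) : normc z <= `|complex.Re z| + `|complex.Im z|.
Proof.
case: z => a b /=; rewrite -[leRHS]ger0_norm ?addr_ge0// -sqrtr_sqr ler_wsqrtr//.
rewrite sqrrD !real_normK ?num_real// addrAC lerDl mulrn_wge0// mulr_ge0//.
Qed.

Lemma normcD_le (y z : R[i]) : normc (y + z) <= normc y + normc z.
Proof. exact: le_normcD. Qed.

Lemma normc_opp (z : R[i]) : normc (- z) = normc z.
Proof. by case: z => a b /=; rewrite !sqrrN. Qed.

Lemma normc_real (x : R) : normc x%:C = `|x|.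
Proof. by rewrite /= expr0n addr0 sqrtr_sqr. Qed.

Lemma seq_complete_complex : seq_complete (normc : R[i] -> R).
Proof.
move=> u cu.
have [a Ha] : exists a, forall e, 0 < e -> exists n, forall i, (n <= i)%N ->
    `|complex.Re (u i) - a| <= e.
  apply: (@seq_complete_real (fun i => complex.Re (u i))) => e e0.
  have [n Hn] := cu e e0; exists n => i j ni nj.
  apply: le_trans (Hn i j ni nj); apply: le_trans (Re_le_normc _).
  by case: (u i) (u j) => ? ? [].
have [b Hb] : exists b, forall e, 0 < e -> exists n, forall i, (n <= i)%N ->
    `|complex.Im (u i) - b| <= e.
  apply: (@seq_complete_real (fun i => complex.Im (u i))) => e e0.
  have [n Hn] := cu e e0; exists n => i j ni nj.
  apply: le_trans (Hn i j ni nj); apply: le_trans (Im_le_normc _).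
  by case: (u i) (u j) => ? ? [].
exists (a +i* b) => e e0.
have e20 : 0 < e / 2 by rewrite divr_gt0.
have [n Hn] := Ha _ e20; have [k Hk] := Hb _ e20.
exists (maxn n k) => i; rewrite geq_max => /andP[/Hn Hni /Hk Hki].
apply: (le_trans (normc_le_ReIm _)).
rewrite [e]splitr; apply: le_trans (lerD Hni Hki).
by case: (u i).
Qed.

End SequentialCompleteness.

(** * Closed subspaces and their finite-dimensional extensions *)

Section NormedSpace.
Variables (R : realType) (V : lmodType R[i]) (N : V -> R).
Hypotheses (ND : forall x y, N (x + y) <= N x + N y)
  (NZ : forall a x, N (a *: x) = normc a * N x)
  (Ncomplete : seq_complete N).

Lemma seminorm0 : N 0 = 0.
Proof. by rewrite -(scale0r (0 : V)) NZ Normc.normc0 mul0r. Qed.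

Lemma seminormN x : N (- x) = N x.
Proof. by rewrite -scaleN1r NZ normc_opp Normc.normc1 mul1r. Qed.

Lemma seminormBC x y : N (x - y) = N (y - x).
Proof. by rewrite -seminormN opprB. Qed.

Lemma seminorm_ge0 x : 0 <= N x.
Proof.
have := ND x (- x); rewrite subrr seminorm0 seminormN; lra.
Qed.

Lemma seminormB_le x y z : N (x - z) <= N (x - y) + N (y - z).
Proof. by rewrite -[x - z](subrKA y) ND. Qed.

Lemma seminorm_sum_le n (c : 'I_n -> R[i]) (v : 'I_n -> V) b :
  (forall i, normc (c i) <= b) ->
  N (\sum_i c i *: v i) <= b * \sum_i N (v i).
Proof.
move=> cb; rewrite mulr_sumr; elim/big_ind2 : _ => [|x r y s xr ys|i _].
- by rewrite seminorm0.
- by apply: (le_trans (ND _ _)); exact: lerD.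
- by rewrite NZ ler_wpM2r// seminorm_ge0.
Qed.

Definition norm_closed (U : set V) := forall x,
  (forall e, 0 < e -> exists2 y, U y & N (x - y) <= e) -> U x.

(** A positive [d] below the distance from [v] to [U] works: factor [c] out of [u + c *: v]. *)
Lemma norm_closed_dist U v : subspace_set U -> norm_closed U -> ~ U v ->
  exists2 d, 0 < d & forall u c, U u -> d * normc c <= N (u + c *: v).
Proof.
move=> sU cU nUv.
have [d d0 Hd] : exists2 d, 0 < d & forall u, U u -> d <= N (v - u).
  apply: contrapT => H; apply: nUv; apply: cU => e e0.
  apply: contrapT => H2; apply: H; exists e => // u Uu.
  rewrite leNgt; apply/negP => Hlt; apply: H2; exists u => //; exact: ltW.
exists d => // u c Uu; have [->|c0] := eqVneq c 0.
  by rewrite Normc.normc0 mulr0 seminorm_ge0.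
have -> : u + c *: v = c *: (v - (- c^-1) *: u).
  by rewrite scaleNr opprK scalerDr scalerA mulfV// scale1r addrC.
rewrite NZ mulrC ler_wpM2l ?normc_ge0//; apply: Hd.
exact: subspaceZ.
Qed.

Definition add_line (U : set V) v : set V :=
  [set x | exists2 c : R[i], U (x - c *: v) & True].

Lemma add_line_subspace U v : subspace_set U -> subspace_set (add_line U v).
Proof.
move=> sU; split; first by exists 0 => //; rewrite scale0r subr0; case: sU.
move=> a x y [c Ux _] [d Uy _]; exists (a * c + d) => //.
by rewrite scalerDl -scalerA opprD addrACA -scalerBr; case: sU => _; exact.
Qed.

Lemma norm_closed_seq (U : set V) x :
  (forall e, 0 < e -> exists2 y, U y & N (x - y) <= e) ->
  exists u : nat -> V, (forall k, U (u k)) /\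
    forall e, 0 < e -> exists n, forall i, (n <= i)%N -> N (x - u i) <= e.
Proof.
move=> Hx; have /choice[u Hu] (k : nat) : exists y, U y /\ N (x - y) <= k.+1%:R^-1.
  by have [] := Hx k.+1%:R^-1; [rewrite invr_gt0 ltr0Sn|move=> y; exists y].
exists u; split => [k|e e0]; first by case: (Hu k).
exists (Num.truncn e^-1) => i ni; case: (Hu i) => _ /le_trans; apply.
rewrite -[leRHS]invrK lef_pV2 ?posrE ?invr_gt0 ?ltr0Sn//.
by rewrite (le_trans (ltW (truncnS_gt _)))// ler_nat.
Qed.

Lemma approx_cauchy (u : nat -> V) x :
  (forall e, 0 < e -> exists n, forall i, (n <= i)%N -> N (x - u i) <= e) ->
  forall e, 0 < e -> exists n, forall i j, (n <= i)%N -> (n <= j)%N ->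
    N (u i - u j) <= e.
Proof.
move=> ux e e0; have e20 : 0 < e / 2 by rewrite divr_gt0.
have [n Hn] := ux _ e20; exists n => i j /Hn Hi /Hn Hj.
rewrite [e]splitr; apply: (le_trans (seminormB_le _ x _)).
by rewrite seminormBC lerD.
Qed.

(** Along an approximating sequence the coefficients of [v] are Cauchy by [norm_closed_dist];
    subtracting their limit times [v] leaves a limit of points of [U]. *)
Lemma add_line_closed U v : subspace_set U -> norm_closed U -> ~ U v ->
  norm_closed (add_line U v).
Proof.
move=> sU cU nUv x /norm_closed_seq[u [Uu ux]].
have [d d0 Hd] := norm_closed_dist sU cU nUv.
have /choice[c Hc] k : exists c : R[i], U (u k - c *: v).
  by have [c Uc _] := Uu k; exists c.
have [l Hl] : exists l : R[i], forall e, 0 < e ->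
    exists n, forall i, (n <= i)%N -> normc (c i - l) <= e.
  apply: seq_complete_complex => e e0.
  have [n Hn] := approx_cauchy ux (mulr_gt0 d0 e0).
  exists n => i j ni nj; rewrite -(ler_pM2l d0); apply: le_trans (Hn i j ni nj).
  apply: le_trans (Hd _ _ (subspaceB sU (Hc i) (Hc j))) _.
  by rewrite scalerBl opprB addrAC !subrKA.
exists l => //; apply: cU => e e0.
have e20 : 0 < e / 2 by rewrite divr_gt0.
have [n Hn] := ux _ e20.
have vp : 0 < N v + 1 by rewrite ltr_wpDl// seminorm_ge0.
have [k Hk] := Hl _ (divr_gt0 e20 vp).
pose i := maxn n k; exists (u i - c i *: v) => //.
have -> : x - l *: v - (u i - c i *: v) = (x - u i) + (c i - l) *: v.
  by rewrite scalerBl opprB addrACA [RHS]addrACA [- (l *: v) + _]addrC.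
rewrite [e]splitr; apply: (le_trans (ND _ _)); apply: lerD.
  by apply: Hn; rewrite leq_maxl.
rewrite NZ; apply: (@le_trans _ _ (e / 2 / (N v + 1) * (N v + 1))).
  apply: ler_pM; rewrite ?normc_ge0 ?seminorm_ge0//; last by rewrite lerDl.
  by apply: Hk; rewrite leq_maxr.
by rewrite divfK// gt_eqF.
Qed.

(** Induction on the family, absorbing the first vector into the subspace. The constant [d] makes
    the coordinates along [v] bounded functionals that vanish on [U]. *)
Lemma free_mod_closed n (U : set V) (v : 'I_n -> V) :
  subspace_set U -> norm_closed U -> free_mod U v ->
  norm_closed (span_mod U v) /\
  exists2 d, 0 < d & forall u c, U u -> forall i, d * normc (c i) <=
    N (u + \sum_i c i *: v i).
Proof.
elim: n U v => [|n IH] U v sU cU fv.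
  split; last by exists 1 => // u c _ [].
  move=> x Hx; exists (fun=> 0) => //; rewrite big_ord0 subr0; apply: cU => e e0.
  by have [y [c + _]] := Hx e e0; rewrite big_ord0 subr0; exists y.
have nUv : ~ U (v ord0).
  move=> Uv; have := fv (fun i => (i == ord0)%:R) _ ord0.
  rewrite eqxx big_ord_recl scale1r big1 ?addr0; last first.
    by move=> i _; rewrite scale0r.
  by move=> /(_ Uv)/eqP; rewrite oner_eq0.
pose U' := add_line U (v ord0); pose v' i := v (lift ord0 i).
have sU' : subspace_set U' by exact: add_line_subspace.
have cU' : norm_closed U' by exact: add_line_closed.
have fv' : free_mod U' v'.
  move=> c [a Ua _] i.
  have := fv (fun i => if unlift ord0 i is Some j then c j else - a) _ (lift ord0 i).
  rewrite liftK; apply; rewrite big_ord_recl unlift_none.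
  under eq_bigr do rewrite liftK.
  by rewrite scaleNr addrC.
have [csp [d' d'0 Hd']] := IH U' v' sU' cU' fv'.
split.
  move=> x Hx; have [c [a Ua _] _] : span_mod U' v' x.
    apply: csp => e e0; have [y [c Uc _] xy] := Hx e e0; exists y => //.
    exists (fun i => c (lift ord0 i)) => //; exists (c ord0) => //.
    by move: Uc; rewrite big_ord_recl opprD addrA addrAC.
  exists (fun i => if unlift ord0 i is Some j then c j else a) => //.
  rewrite big_ord_recl unlift_none; under eq_bigr do rewrite liftK.
  by rewrite opprD addrA addrAC.
have [d0 d00 Hd0] := norm_closed_dist sU cU nUv.
pose S := \sum_i N (v' i).
have S0 : 0 <= S by apply: sumr_ge0 => i _; exact: seminorm_ge0.
have p : 0 < 1 + S / d' by rewrite ltr_pwDl// divr_ge0// ltW.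
(* [d'] controls all coefficients but the first. Subtracting these terms, of norm at most
   [t / d' * S], leaves [u + c ord0 *: v ord0], whence the factor [1 + S / d']. *)
exists (Num.min d' (d0 / (1 + S / d'))); first by rewrite lt_min d'0 divr_gt0.
move=> u c Uu i.
have tail : forall j, d' * normc (c (lift ord0 j)) <= N (u + \sum_i c i *: v i).
  move=> j; rewrite big_ord_recl addrA.
  apply: (Hd' _ (fun j => c (lift ord0 j))); exists (c ord0) => //.
  by rewrite addrK.
case: (unliftP ord0 i) => [j ->|->].
  apply: le_trans (tail j); rewrite ler_wpM2r ?normc_ge0//.
  by rewrite ge_min lexx.
set t := N (u + _).
apply: (@le_trans _ _ (d0 / (1 + S / d') * normc (c ord0))).
  by rewrite ler_wpM2r ?normc_ge0// ge_min lexx orbT.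
rewrite mulrAC ler_pdivrMr//; apply: le_trans (Hd0 u _ Uu) _.
have -> : u + c ord0 *: v ord0 =
    (u + \sum_i c i *: v i) - \sum_i c (lift ord0 i) *: v' i.
  by rewrite big_ord_recl addrA addrK.
apply: (le_trans (ND _ _)); rewrite seminormN -/t mulrDr mulr1 lerD2l.
rewrite mulrCA mulrC; apply: (@seminorm_sum_le _ _ _ (t / d')) => j.
by rewrite ler_pdivlMr// mulrC; exact: tail.
Qed.

End NormedSpace.

(** * Stability of the defect *)

(** The indicator of [Q] is continuous on [0, 1] and never equals 1/2, so the intermediate value
    theorem makes its end values agree. *)
Lemma locally_constant_segment (R : realType) (Q : R -> Prop) :
  (forall t, 0 <= t <= 1 -> exists2 e, 0 < e &
    forall s, 0 <= s <= 1 -> `|s - t| <= e -> (Q t <-> Q s)) ->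
  Q 0 <-> Q 1.
Proof.
move=> locQ; pose g (t : R) : R := if `[< Q t >] then 1 else 0.
have gE s t : (Q s <-> Q t) -> g s = g t.
  by move=> st; rewrite /g; congr (if _ then _ else _); apply: asbool_equiv_eq.
have cg : {within `[0, 1], continuous g}.
  apply/subspace_continuousP => t /=; rewrite in_itv/= => t01.
  have [e e0 He] := locQ t t01.
  apply: cvg_near_cst.
  rewrite near_withinE; near=> s => s01; apply/esym/gE/He => //.
have [|g01] := eqVneq (g 0) (g 1).
  rewrite /g; case: asboolP; case: asboolP => // _ _ /eqP.
    by rewrite oner_eq0.
  by rewrite eq_sym oner_eq0.
have [] := @IVT R g 0 1 (1 / 2) ler01 cg.
  by move: g01; rewrite /g; case: asboolP; case: asboolP => //;
    rewrite ?eqxx// => _ _ _;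
    rewrite /Num.min /Num.max ?ltr01 ?ltr10; apply/andP; split; lra.
move=> t _; rewrite /g; case: asboolP => _; lra.
Unshelve. all: by end_near. Qed.

Section Pencil.
Variables (R : realType) (V : lmodType R[i]) (N : V -> R).
Hypotheses (ND : forall x y, N (x + y) <= N x + N y)
  (NZ : forall a x, N (a *: x) = normc a * N x)
  (N_eq0 : forall x, N x = 0 -> x = 0)
  (Ncomplete : seq_complete N).

Let N_ge0 := seminorm_ge0 ND NZ.
Let NN := seminormN NZ.

(** Approximating the successive remainders yields points of [U] within [N x / 2 ^+ k] of [x], so
    [U] is dense as well as closed. *)
Lemma norm_closed_halving (U : set V) : subspace_set U -> norm_closed N U ->
  (forall x, exists2 y, U y & N (x - y) <= N x / 2) -> forall x, U x.
Proof.
move=> sU cU HU x; apply: cU => e e0.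
have it k : exists2 y, U y & N (x - y) <= N x / 2 ^+ k.
  elim: k => [|k [y Uy Hy]].
    by exists 0; [case: sU|rewrite subr0 expr0 divr1].
  have [z Uz Hz] := HU (x - y); exists (y + z); first exact: subspaceD.
  rewrite opprD addrA (le_trans Hz)// exprSr invfM mulrA ler_pM2r//.
have [y Uy Hy] := it (Num.truncn (N x / e)).+1.
exists y => //; apply: (le_trans Hy); rewrite ler_pdivrMr ?exprn_gt0//.
rewrite -ler_pdivrMl// mulrC; apply: (le_trans (ltW (truncnS_gt _))).
by rewrite -natrX ler_nat ltnW// ltn_expl.
Qed.

(** The lower bound makes preimages of a convergent sequence Cauchy; the upper bound carries their
    limit to the limit of the images. *)
Lemma bounded_below_range_closed (A : {linear V -> V}) B c : 0 < c ->
  (forall f, N (A f) <= B * N f) -> (forall f, c * N f <= N (A f)) ->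
  norm_closed N (range A).
Proof.
move=> c0 AB Ac x /(norm_closed_seq)[u [Uu ux]].
have /choice[f Hf] k : exists f, A f = u k by have [f _ <-] := Uu k; exists f.
have [g Hg] : exists g, forall e, 0 < e -> exists n, forall i, (n <= i)%N ->
    N (f i - g) <= e.
  apply: Ncomplete => e e0.
  have [n Hn] := approx_cauchy ND NZ ux (mulr_gt0 c0 e0).
  exists n => i j ni nj; rewrite -(ler_pM2l c0).
  apply: le_trans (Ac _) _; rewrite linearB !Hf; exact: Hn.
exists g => //; apply/esym/eqP; rewrite -subr_eq0; apply/eqP/N_eq0/eqP.
rewrite eq_le N_ge0 andbT; apply/ler_addgt0Pr => e e0; rewrite add0r.
have e20 : 0 < e / 2 by rewrite divr_gt0.
have [n Hn] := ux _ e20.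
have B1 : 0 < `|B| + 1 by rewrite ltr_wpDl.
have [k Hk] := Hg _ (divr_gt0 e20 B1).
pose i := maxn n k.
apply: (le_trans (seminormB_le ND _ (u i) _)).
rewrite [e]splitr lerD//; first by apply: Hn; rewrite leq_maxl.
rewrite -Hf -linearB (le_trans (AB _))//.
apply: (@le_trans _ _ ((`|B| + 1) * (e / 2 / (`|B| + 1)))).
  apply: (@le_trans _ _ ((`|B| + 1) * N (f i - g))).
    by rewrite ler_wpM2r// (le_trans (ler_norm _))// lerDl.
  by rewrite ler_pM2l//; apply: Hk; rewrite leq_maxr.
by rewrite mulrC divfK// gt_eqF.
Qed.

Variables (T : {linear V -> V}) (B : R).
Hypothesis TB : forall f, N (T f) <= B * N f.
Variables (c l : R).
Hypotheses (c0 : 0 < c)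
  (Tc : forall mu, normc mu <= l -> forall f, c * N f <= N (mu *: f - T f)).

Local Notation pencil mu := (mu \*: idfun \- T : {linear V -> V}).

Lemma pencil_le mu f : N (pencil mu f) <= (normc mu + B) * N f.
Proof.
by rewrite mulrDl -NZ (le_trans (ND _ _))// lerD2l NN TB.
Qed.

Lemma pencil_range_closed mu : normc mu <= l -> norm_closed N (range (pencil mu)).
Proof.
by move=> mul; apply: (bounded_below_range_closed c0 (pencil_le mu)); exact: Tc.
Qed.

(** A relation at [nu], with preimage [f], reads at [mu] as [pencil mu (- f)] plus the combination
    of [v] being equal to [(nu - mu) *: f]. Its coefficients are thus small against [N f], while the
    lower bound at [nu] controls [N f] by them; for [nu] close to [mu] both must vanish. *)
Lemma free_mod_near mu n (v : 'I_n -> V) : normc mu <= l ->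
  free_mod (range (pencil mu)) v -> exists2 e, 0 < e & forall nu, normc nu <= l ->
    normc (nu - mu) <= e -> free_mod (range (pencil nu)) v.
Proof.
move=> mul fv.
have [_ [d d0 Hd]] := free_mod_closed ND NZ (range_subspace _)
  (pencil_range_closed mul) fv.
pose S := \sum_i N (v i).
have S0 : 0 <= S by apply: sumr_ge0 => i _; exact: N_ge0.
have S1 : 0 < S + 1 by rewrite ltr_wpDl.
(* With this radius the two estimates combine into [c * N f <= c / 2 * N f]. *)
exists (c * d / (2 * (S + 1))); first by rewrite divr_gt0 ?mulr_gt0.
move=> nu nul numu a [f _ Hf] i.
set e := c * d / _ in numu.
have ai j : normc (a j) <= e * N f / d.
  rewrite ler_pdivlMr// mulrC.
  apply: (le_trans (Hd (pencil mu (- f)) a _ j)); first by exists (- f).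
  have -> : pencil mu (- f) + \sum_i a i *: v i = (nu - mu) *: f.
    by rewrite -Hf/= scalerN linearN opprK scalerBl addrACA subrr addr0 addrC.
  by rewrite NZ ler_wpM2r.
have cf : c * N f <= e * N f / d * S.
  apply: (le_trans (Tc nul f)); rewrite -[X in N X]/(pencil nu f) Hf.
  exact: (seminorm_sum_le ND NZ).
have Nf : N f = 0.
  apply/eqP; rewrite eq_le N_ge0 andbT leNgt; apply/negP => Nf0.
  have : c * N f <= c / 2 * N f.
    apply: (le_trans cf); rewrite /e.
    rewrite (_ : _ / d * S = c / 2 * N f * (S / (S + 1))); last first.
      by field; rewrite !gt_eqF.
    rewrite ler_piMr ?mulr_ge0 ?(ltW Nf0) ?divr_ge0// ?(ltW c0)//.
    by rewrite ler_pdivrMr// mul1r lerDl.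
  rewrite ler_pM2r//; have := c0; lra.
apply: Normc.eq0_normc; apply/eqP; rewrite eq_le normc_ge0 andbT.
by have := ai i; rewrite Nf mulr0 mul0r.
Qed.

(** Decompose [x] at [mu] and replace [pencil mu f] by [pencil nu f]: the error [(mu - nu) *: f] has
    norm at most [N x / 2]. The span at [nu] is closed, as [v] remains free there, so
    [norm_closed_halving] applies. *)
Lemma span_mod_near mu n (v : 'I_n -> V) : normc mu <= l ->
  free_mod (range (pencil mu)) v -> (forall x, span_mod (range (pencil mu)) v x) ->
  exists2 e, 0 < e & forall nu, normc nu <= l -> normc (nu - mu) <= e ->
    forall x, span_mod (range (pencil nu)) v x.
Proof.
move=> mul fv sv.
have [_ [d d0 Hd]] := free_mod_closed ND NZ (range_subspace _)
  (pencil_range_closed mul) fv.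
have [e1 e10 He1] := free_mod_near mul fv.
pose S := \sum_i N (v i).
have S0 : 0 <= S by apply: sumr_ge0 => i _; exact: N_ge0.
have S1 : 0 < 1 + S / d by rewrite ltr_pwDl// divr_ge0// ltW.
pose e := Num.min e1 (c / (2 * (1 + S / d))).
exists e; first by rewrite lt_min e10 divr_gt0 ?mulr_gt0.
move=> nu nul numu; have ee1 : e <= e1 by rewrite ge_min lexx.
have [cl _] := free_mod_closed ND NZ (range_subspace _)
  (pencil_range_closed nul) (He1 nu nul (le_trans numu ee1)).
apply: norm_closed_halving => // [|x].
  by apply: span_mod_subspace; exact: range_subspace.
have [a [f _ Hf] _] := sv x.
exists (pencil nu f + \sum_i a i *: v i).
  by exists a => //; rewrite addrK; exists f.
have xE : x = pencil mu f + \sum_i a i *: v i by rewrite Hf subrK.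
have ai i : normc (a i) <= N x / d.
  rewrite ler_pdivlMr// mulrC xE; apply: Hd; by exists f.
have cf : c * N f <= N x * (1 + S / d).
  apply: (le_trans (Tc mul f)); rewrite -[X in N X]/(pencil mu f) Hf.
  apply: (le_trans (ND _ _)); rewrite NN mulrDr mulr1 lerD2l mulrCA mulrC.
  exact: (seminorm_sum_le ND NZ).
have -> : x - (pencil nu f + \sum_i a i *: v i) = (mu - nu) *: f.
  by rewrite {1}xE opprD addrACA subrr addr0/= opprB addrA subrK scalerBl.
rewrite NZ -normc_opp opprB.
apply: (@le_trans _ _ (c / (2 * (1 + S / d)) * N f)).
  by rewrite ler_wpM2r// (le_trans numu)// ge_min lexx orbT.
rewrite mulrAC ler_pdivrMr ?mulr_gt0//; apply: (le_trans cf).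
by rewrite mulrA divfK ?pnatr_eq0.
Qed.

(* Independent families persist under small perturbations, and so do spanning
   ones: both [defect >= n] and [defect < n] are open conditions. *)
Lemma has_free_mod_near mu n : normc mu <= l -> exists2 e, 0 < e & forall nu,
  normc nu <= l -> normc (nu - mu) <= e ->
  (has_free_mod (range (pencil mu)) n <-> has_free_mod (range (pencil nu)) n).
Proof.
move=> mul.
have [[v fv]|nP] := pselect (has_free_mod (range (pencil mu)) n).
  have [e e0 He] := free_mod_near mul fv; exists e => // nu nul numu.
  by split => _; exists v => //; exact: He.
have [m [u [mn fu su]]] := not_has_free_mod (range_subspace _) nP.
have [e e0 He] := span_mod_near mul fu su; exists e => // nu nul numu.
split => // -[v fv].
have := free_span_card (range_subspace _) (He nu nul numu) fv.
by rewrite leqNgt mn.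
Qed.

(** The segment from 0 to [mu] stays in the disc where the lower bound [c] is uniform, so the local
    constancy just proved propagates along it. *)
Lemma has_free_mod_pencil mu n : normc mu <= l ->
  (has_free_mod (range (pencil 0)) n <-> has_free_mod (range (pencil mu)) n).
Proof.
move=> mul.
have tmul (t : R) : 0 <= t <= 1 -> normc (t%:C * mu) <= l.
  move=> /andP[t0 t1]; rewrite Normc.normcM normc_real ger0_norm//.
  by rewrite (le_trans _ mul)// ler_piMl// normc_ge0.
have := @locally_constant_segment R
  (fun t => has_free_mod (range (pencil (t%:C * mu))) n).
rewrite !mul0r !mul1r; apply => t t01.
have [e e0 He] := has_free_mod_near n (tmul t t01).
have m1 : 0 < normc mu + 1 by rewrite ltr_wpDl// normc_ge0.
exists (e / (normc mu + 1)); first by rewrite divr_gt0.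
move=> s s01 st; apply: He; first exact: tmul.
rewrite -mulrBl -rmorphB/= Normc.normcM normc_real.
apply: (@le_trans _ _ (e / (normc mu + 1) * (normc mu + 1))).
  by apply: ler_pM => //; [exact: normc_ge0|rewrite lerDl].
by rewrite divfK// gt_eqF.
Qed.

End Pencil.

(** * Regularization of a finitely additive probability *)

Section ContentRegularization.
Context {R : realType} {K : ptopologicalType}.
Hypotheses (cK : compact [set: K]) (hK : hausdorff_space K).
Variable m : set K -> R.
Hypotheses (m_ge0 : forall A, 0 <= m A) (mT : m setT = 1)
  (mU : forall A B, A `&` B = set0 -> m (A `|` B) = m A + m B).

Lemma content0 : m set0 = 0.
Proof.
have := mU (set0I set0); rewrite setU0 => /eqP.
by rewrite -subr_eq0 opprD addrA subrr sub0r oppr_eq0 => /eqP.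
Qed.

Lemma content_le A B : A `<=` B -> m A <= m B.
Proof.
move=> AB; rewrite -(setUIDK B A) (setIidr AB) mU ?lerDl//.
by rewrite setDE setICA setICr setI0.
Qed.

Lemma content_le1 A : m A <= 1.
Proof. by rewrite -mT; apply: content_le. Qed.

Definition inner_mass (U : set K) : R :=
  sup [set m C | C in [set C | closed C /\ C `<=` U]].

(** The two-step extension of Riesz-Markov type: inner approximation by closed sets on open sets,
    then outer approximation by open sets. *)
Definition regular_outer (A : set K) : \bar R :=
  ereal_inf [set (inner_mass U)%:E | U in [set U | open U /\ A `<=` U]].

Lemma inner_mass_has_sup U :
  has_sup [set m C | C in [set C | closed C /\ C `<=` U]].
Proof.
split; first by exists (m set0), set0 => //; split => //; exact: closed0.
by exists 1 => _ [C _ <-]; exact: content_le1.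
Qed.

Lemma le_inner_mass C U : closed C -> C `<=` U -> m C <= inner_mass U.
Proof. by move=> cC CU; apply: ub_le_sup; [case: (inner_mass_has_sup U)|exists C]. Qed.

Lemma inner_mass_le U x :
  (forall C, closed C -> C `<=` U -> m C <= x) -> inner_mass U <= x.
Proof.
move=> Ux; apply: ge_sup; first by case: (inner_mass_has_sup U).
by move=> _ [C [cC CU] <-]; exact: Ux.
Qed.

Lemma inner_mass_adherent U e : 0 < e ->
  exists C, [/\ closed C, C `<=` U & inner_mass U - e < m C].
Proof.
move=> e0; have [_ [C [cC CU] <-] ?] := sup_adherent e0 (inner_mass_has_sup U).
by exists C.
Qed.

Lemma inner_mass_le_content U : inner_mass U <= m U.
Proof. by apply: inner_mass_le => C _; exact: content_le. Qed.

Lemma inner_mass_ge0 U : 0 <= inner_mass U.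
Proof.
by rewrite -content0; apply: le_inner_mass; [exact: closed0|exact: sub0set].
Qed.

Lemma inner_massS U V : U `<=` V -> inner_mass U <= inner_mass V.
Proof.
move=> UV; apply: inner_mass_le => C cC CU.
by apply: le_inner_mass => //; exact: subset_trans UV.
Qed.

Lemma inner_massT : inner_mass setT = 1.
Proof.
apply/eqP; rewrite eq_le -mT inner_mass_le_content/=.
by apply: le_inner_mass; [exact: closedT|].
Qed.

Lemma contentU_le A B : m (A `|` B) <= m A + m B.
Proof.
have -> : A `|` B = A `|` B `\` A.
  apply/seteqP; split=> [x [Ax|Bx]|x [Ax|[Bx _]]]; [by left| |by left|by right].
  by have [Ax|nAx] := pselect (A x); [left|right].
rewrite mU; last by rewrite setDE setICA setICr setI0.
by rewrite lerD2l; apply: content_le => x [].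
Qed.

(** Normality separates [C \ V] and [C \ U] by disjoint open sets [G1] and [G2]; then [C] is the
    union of the closed sets [C \ G2] inside [U] and [C \ G1] inside [V]. *)
Lemma inner_massU_le U V : open U -> open V ->
  inner_mass (U `|` V) <= inner_mass U + inner_mass V.
Proof.
move=> oU oV; apply: inner_mass_le => C cC CUV.
have [] := (@normal_openP R K).1 (compact_normal hK cK) (C `\` V) (C `\` U).
- by apply: closedI => //; exact: open_closedC.
- by apply: closedI => //; exact: open_closedC.
- rewrite -subset0 => x [[Cx nV] [_ nU]]; by case: (CUV x Cx).
move=> G1 [G2 [oG1 oG2 CG1 CG2 G12]].
have -> : C = (C `\` G2) `|` (C `\` G1).
  apply/seteqP; split => [x Cx|x [[]|[]]//].
  have [G2x|nO2x] := pselect (G2 x); last by left.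
  right; split => // G1x; have : (G1 `&` G2) x by [].
  by rewrite G12.
apply: (le_trans (contentU_le _ _)); apply: lerD; apply: le_inner_mass.
- by apply: closedI => //; exact: open_closedC.
- by move=> x [Cx nO]; apply: contrapT => nU; apply: nO; apply: CG2.
- by apply: closedI => //; exact: open_closedC.
- by move=> x [Cx nO]; apply: contrapT => nU; apply: nO; apply: CG1.
Qed.

Lemma inner_mass_bigsetU_le (U : (set K)^nat) n : (forall i, open (U i)) ->
  inner_mass (\big[setU/set0]_(i < n) U i) <= \sum_(i < n) inner_mass (U i).
Proof.
move=> oU; elim: n => [|n IH].
  rewrite !big_ord0; apply: inner_mass_le => C _; rewrite subset0 => ->.
  by rewrite content0.
rewrite !big_ord_recr/=; apply: le_trans (lerD IH (lexx _)).
by apply: inner_massU_le => //; apply: big_ind => //; [exact: open0|exact: openU].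
Qed.

Lemma closed_sub_bigcup (U : (set K)^nat) C : (forall i, open (U i)) ->
  closed C -> C `<=` \bigcup_i U i ->
  exists n, C `<=` \big[setU/set0]_(i < n) U i.
Proof.
move=> oU cC CU.
have : compact C by apply: (subclosed_compact cC cK).
move=> /compact_near_coveringP/(_ nat \oo
  (fun n x => (\big[setU/set0]_(i < n) U i) x) _)[].
  move=> x /CU[i _ Uix]; near_simpl.
  exists (U i, [set n | (i < n)%N]) => /=.
    split; first exact: open_nbhs_nbhs.
    by exists i.+1.
  move=> [y n]/= [Uiy ltin]; rewrite -bigcup_mkord; by exists i.
by move=> n _ Cn; exists n; apply: Cn => /=.
Unshelve. all: by end_near. Qed.

(** Compactness upgrades finite to countable subadditivity: a closed subset of the union already
    lies in a finite partial union. *)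
Lemma inner_mass_bigcup_le (U : (set K)^nat) : (forall i, open (U i)) ->
  ((inner_mass (\bigcup_i U i))%:E <= \sum_(i <oo) (inner_mass (U i))%:E)%E.
Proof.
move=> oU; set s := (X in (_ <= X)%E).
have sn n : (\sum_(i < n) (inner_mass (U i))%:E <= s)%E.
  rewrite /s -(big_mkord xpredT (fun i => (inner_mass (U i))%:E)).
  by apply: nneseries_lim_ge => i _ _; rewrite lee_fin inner_mass_ge0.
have : forall C, closed C -> C `<=` \bigcup_i U i -> ((m C)%:E <= s)%E.
  move=> C cC CU; have [n Cn] := closed_sub_bigcup oU cC CU.
  apply: le_trans (sn n); rewrite sumEFin lee_fin.
  apply: le_trans (inner_mass_bigsetU_le n oU); exact: le_inner_mass.
case: s {sn} => [r| |] H.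
- by rewrite lee_fin; apply: inner_mass_le => C cC CU; rewrite -lee_fin H.
- by rewrite leey.
- have := H set0 closed0 (@sub0set _ _); by rewrite leeNy_eq.
Qed.

Lemma regular_outer_open U : open U -> regular_outer U = (inner_mass U)%:E.
Proof.
move=> oU; apply/eqP; rewrite eq_le; apply/andP; split.
  by apply: ereal_inf_lbound => /=; exists U => //; split.
apply: le_ereal_inf_tmp => _ [V [oV UV] <-]; rewrite lee_fin.
exact: inner_massS.
Qed.

Lemma regular_outer_ge0 A : (0 <= regular_outer A)%E.
Proof.
by apply: le_ereal_inf_tmp => _ [V _ <-]; rewrite lee_fin inner_mass_ge0.
Qed.

Lemma regular_outer0 : regular_outer set0 = 0%E.
Proof.
rewrite regular_outer_open; last exact: open0.
congr (_%:E); apply/eqP; rewrite eq_le inner_mass_ge0 andbT.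
by rewrite -content0 inner_mass_le_content.
Qed.

Lemma le_regular_outer A B : A `<=` B -> (regular_outer A <= regular_outer B)%E.
Proof.
move=> AB; apply: ereal_inf_le_tmp => _ [U [oU BU] <-]; exists U => //.
by split => //; exact: subset_trans BU.
Qed.

Lemma regular_outer_fin A : regular_outer A \is a fin_num.
Proof.
rewrite ge0_fin_numE ?regular_outer_ge0//.
apply: (@le_lt_trans _ _ 1%E); last exact: ltry.
rewrite -[1%E]/(1%R%:E) -inner_massT -regular_outer_open; last exact: openT.
exact: le_regular_outer.
Qed.

Lemma regular_outer_adherent A e : 0 < e -> exists U, [/\ open U, A `<=` U &
  ((inner_mass U)%:E <= regular_outer A + e%:E)%E].
Proof.
move=> e0; have [_ [U [oU AU] <-] ?] :=
  lb_ereal_inf_adherent e0 (regular_outer_fin A).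
by exists U; split => //; exact: ltW.
Qed.

Lemma regular_outer_sigma_subadditive : sigma_subadditive regular_outer.
Proof.
move=> F; apply/lee_addgt0Pr => e e0.
have /choice[U HU] (n : nat) := @regular_outer_adherent (F n) (e / (2 ^ n.+1)%:R)
   ltac:(by rewrite divr_gt0// ltr0n expn_gt0).
apply: le_trans (epsilon_trick _ (fun=> regular_outer_ge0 _) (ltW e0)).
apply: le_trans (_ : (\sum_(i <oo) (inner_mass (U i))%:E <= _)%E); last first.
  apply: lee_nneseries => i _; first by rewrite lee_fin inner_mass_ge0.
  by case: (HU i).
apply: le_trans (inner_mass_bigcup_le _); last by move=> i; case: (HU i).
rewrite -regular_outer_open; last by apply: bigcup_open => i _; case: (HU i).
apply: le_regular_outer => x [i _ Fx]; exists i => //.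
by case: (HU i) => _ + _; apply.
Qed.

Definition regular_outer_measure : {outer_measure set K -> \bar R} :=
  HB.pack regular_outer (isOuterMeasure.Build R K regular_outer regular_outer0
    regular_outer_ge0 le_regular_outer regular_outer_sigma_subadditive).

(** Take an open [V] around [X], a closed [C] inside [V] and [U], and a closed [D] inside [V] minus
    [C], each optimal up to [e / 3]. Removing [C] rather than [U] keeps the set open while still
    covering [X] outside [U]; and [C], [D] are disjoint closed subsets of [V], so their contents add
    up to at most its mass. *)
Lemma open_caratheodory U : open U -> regular_outer_measure.-caratheodory U.
Proof.
move=> oU; apply: le_caratheodory_measurable => X.
apply/lee_addgt0Pr => e e0.
have e3 : 0 < e / 3 by rewrite divr_gt0.
have [V [oV XV HV]] := @regular_outer_adherent X _ e3.
have [C [cC CVU HC]] := @inner_mass_adherent (V `&` U) _ e3.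
have [D [cD DVC HD]] := @inner_mass_adherent (V `\` C) _ e3.
have XU : (regular_outer (X `&` U) <= (m C + e / 3)%:E)%E.
  apply: (@le_trans _ _ (regular_outer (V `&` U))).
    by apply: le_regular_outer => x [Xx Ux]; split => //; exact: XV.
  rewrite regular_outer_open; last exact: openI.
  by rewrite lee_fin -lerBlDr ltW.
have XnU : (regular_outer (X `&` ~` U) <= (m D + e / 3)%:E)%E.
  apply: (@le_trans _ _ (regular_outer (V `\` C))).
    apply: le_regular_outer => x [Xx nUx]; split; first exact: XV.
    by move=> /CVU[].
  rewrite regular_outer_open; last first.
    by rewrite setDE; apply: openI => //; exact: closed_openC.
  by rewrite lee_fin -lerBlDr ltW.
apply: (le_trans (leeD XU XnU)).
have : m C + m D <= inner_mass V.
  rewrite -mU; last by rewrite -subset0 => x [Cx /DVC[]].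
  by apply: le_inner_mass; [exact: closedU|move=> x [/CVU[]|/DVC[]]].
rewrite -lee_fin => /le_trans/(_ HV).
rewrite -[regular_outer_measure X]/(regular_outer X) -(fineK (regular_outer_fin X)).
rewrite -!EFinD !lee_fin => {}HV.
lra.
Qed.

Lemma borel_caratheodory (A : set (borel_space K)) : measurable A ->
  regular_outer_measure.-caratheodory A.
Proof.
move: A; apply: (@smallest_sub _ _ _
  (regular_outer_measure.-cara.-measurable)) => [|U]; last exact: open_caratheodory.
exact: sigma_algebra_measurable.
Qed.

Lemma regular_outer_semi_sigma_additive :
  semi_sigma_additive (regular_outer : set (borel_space K) -> \bar R).
Proof.
move=> F mF tF mUF.
have := @caratheodory_measure_sigma_additive R K regular_outer_measure F.
by apply => // [i|]; apply: borel_caratheodory.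
Qed.

Lemma regular_outerT : regular_outer setT = 1%E.
Proof. by rewrite regular_outer_open ?inner_massT//; exact: openT. Qed.

Definition regularization : set (borel_space K) -> \bar R := regular_outer.

HB.instance Definition _ := isMeasure.Build _ (borel_space K) R regularization
  regular_outer0 regular_outer_ge0 regular_outer_semi_sigma_additive.

HB.instance Definition _ := Measure_isProbability.Build _ (borel_space K) R
  regularization regular_outerT.

Lemma regularization_fin (A : set (borel_space K)) : measurable A ->
  exists2 r, regularization A = r%:E & regularization (~` A) = (1 - r)%:E.
Proof.
move=> mA; exists (fine (regularization A)).
  by rewrite fineK// (fin_num_measure regularization).
rewrite (probability_setC regularization)// EFinB fineK//.
exact: (fin_num_measure regularization).
Qed.

Lemma regularization_open U : open U -> regularization U = (inner_mass U)%:E.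
Proof. exact: regular_outer_open. Qed.

(** Outer regularity is built in. For inner regularity, an open set tightly covering the complement
    of [A] has a compact complement inside [A]. *)
Lemma regularization_regular : regular_measure regularization.
Proof.
have outer A : regularization A =
    ereal_inf [set regularization U | U in [set U : set K | open U /\ A `<=` U]].
  rewrite {1}/regularization/= /regular_outer; congr ereal_inf.
  by apply/seteqP; split=> _ [U [oU AU] <-]; exists U => //;
    rewrite regularization_open.
move=> A mA; split; first exact: outer.
apply/eqP; rewrite eq_le; apply/andP; split; last first.
  apply: ge_ereal_sup => _ [C [_ CA] <-].
  exact: le_regular_outer.
apply/lee_addgt0Pr => e e0.
have [U [oU AU HU]] := @regular_outer_adherent (~` A) _ e0.
have cU : closed (~` U) by exact: open_closedC.
have mcU : measurable (U : set (borel_space K)) by exact: sub_sigma_algebra.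
apply: (@le_trans _ _ (regularization (~` U) + e%:E)%E); last first.
  rewrite leeD2r//; apply: ereal_sup_ubound; exists (~` U) => //; split.
    exact: subclosed_compact cU cK _.
  by move=> x nU; apply: contrapT => nA; apply: nU; exact: AU.
have [a Ea Eca] := regularization_fin mA.
have [u Eu Ecu] := regularization_fin mcU.
move: HU; rewrite -regularization_open// -[regular_outer _]/(regularization (~` A)).
change (regularization U <= regularization (~` A) + e%:E ->
  regularization A <= regularization (~` U) + e%:E)%E.
rewrite Ea Eca Eu Ecu -!EFinD !lee_fin; lra.
Qed.

(** This one-sided comparison suffices later: the integral is bounded above through superlevel sets,
    which are open. *)
Lemma regularization_le_content U : open U -> (regularization U <= (m U)%:E)%E.
Proof.
by move=> oU; rewrite regularization_open// lee_fin inner_mass_le_content.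
Qed.

(** Taking preimages cannot decrease the mass of open sets, hence cannot increase that of closed
    sets. For a compact [D] inside the preimage of a Borel set [A], the image of [D] is closed and
    lies in [A], which gives one inequality; complements give the other. *)
Lemma regularization_invariant (f : K -> K) : continuous f ->
  (forall A, m (f @^-1` A) = m A) -> invariant_measure f regularization.
Proof.
move=> cf mf.
have mfA (A : set (borel_space K)) : measurable A ->
    measurable (f @^-1` A : set (borel_space K)).
  have mbf : measurable_fun setT (f : borel_space K -> borel_space K).
    apply: (@measurability _ _ (borel_space K) (borel_space K) _ _ (@open K));
      first by [].
    move=> _ [U oU <-].
    by rewrite setTI; apply: sub_sigma_algebra; apply: open_comp.
  by move=> mA; rewrite -[_ @^-1` _]setTI; exact: mbf.
have Uf U : open U -> (regularization U <= regularization (f @^-1` U))%E.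
  move=> oU; rewrite !regularization_open//; last exact: open_comp.
  rewrite lee_fin; apply: inner_mass_le => C cC CU; rewrite -mf.
  apply: le_inner_mass; last by move=> x /CU.
  exact: closed_comp.
have Cf C : closed C -> (regularization (f @^-1` C) <= regularization C)%E.
  move=> cC; have := Uf (~` C) (closed_openC cC).
  have mC : measurable (C : set (borel_space K)).
    rewrite -[C]setCK; apply: measurableC; apply: sub_sigma_algebra.
    exact: closed_openC.
  rewrite preimage_setC.
  have [c -> ->] := regularization_fin mC.
  have [d -> ->] := regularization_fin (mfA _ mC).
  rewrite !lee_fin; lra.
have Af (A : set (borel_space K)) : measurable A ->
    (regularization (f @^-1` A) <= regularization A)%E.
  move=> mA; have [_ ->] := regularization_regular (mfA _ mA).
  apply: ge_ereal_sup => _ [D [cD DA] <-].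
  have cfD : closed (f @` D).
    apply: compact_closed => //; apply: continuous_compact => //.
    exact: continuous_subspaceT.
  apply: (@le_trans _ _ (regularization (f @^-1` (f @` D)))).
    by apply: le_regular_outer; exact: preimage_image.
  apply: (le_trans (Cf _ cfD)); apply: le_regular_outer.
  by move=> _ [x /DA ? <-].
move=> A mA; apply/eqP; rewrite eq_le Af//=.
have := Af (~` A) (measurableC mA).
rewrite preimage_setC.
change (regularization (~` (f @^-1` A)) <= regularization (~` A) ->
  regularization A <= regularization (f @^-1` A))%E.
have [c -> ->] := regularization_fin mA.
have [d -> ->] := regularization_fin (mfA _ mA).
rewrite !lee_fin; lra.
Qed.

Lemma content_regularization (f : K -> K) : continuous f ->
  (forall A, m (f @^-1` A) = m A) ->
  exists2 mu : probability (borel_space K) R, invariant_probabilities f mu &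
    forall U, open U -> (mu U <= (m U)%:E)%E.
Proof.
move=> cf mf; exists regularization; last exact: regularization_le_content.
by split; [exact: regularization_regular|exact: regularization_invariant].
Qed.

End ContentRegularization.

(** * Ultrafilter limits of empirical measures *)

(** Layer-cake approximation: for [0 <= y <= N%:R * e] its value lies between [y] and [y + e], and
    it is a combination of indicators of superlevel conditions on [y]. *)
Definition staircase {R : realType} (e : R) N (y : R) : R :=
  \sum_(i < N) e * ((i%:R * e < y)%R)%:R.

Section Staircase.
Variables (R : realType) (e : R) (e0 : 0 < e).

Lemma staircase_full N y : N%:R * e <= y -> staircase e N y = N%:R * e.
Proof.
move=> Ny; rewrite /staircase (eq_bigr (fun=> e)).
  by rewrite sumr_const card_ord mulr_natl.
move=> i _; have -> : i%:R * e < y.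
  by apply: lt_le_trans Ny; rewrite ltr_pM2r// ltr_nat ltn_ord.
by rewrite mulr1.
Qed.

Lemma staircase_ge N y : y <= N%:R * e -> y <= staircase e N y.
Proof.
elim: N => [|N IH] yN; first by rewrite /staircase big_ord0; rewrite mul0r in yN.
rewrite /staircase big_ord_recr/= -/(staircase e N y).
have [yle|ylt] := leP y (N%:R * e).
  by rewrite mulr0 addr0 IH.
by rewrite mulr1 (staircase_full (ltW ylt)) -[X in _ + X]mul1r -mulrDl natr1.
Qed.

Lemma staircase_le N y : 0 <= y -> staircase e N y <= y + e.
Proof.
move=> y0; elim: N => [|N IH]; first by rewrite /staircase big_ord0 addr_ge0// ltW.
rewrite /staircase big_ord_recr/= -/(staircase e N y).
have [yle|ylt] := leP y (N%:R * e); first by rewrite mulr0 addr0.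
by rewrite mulr1 (staircase_full (ltW ylt)) lerD2r ltW.
Qed.

End Staircase.

Section EmpiricalContent.
Variables (R : realType) (T : Type) (f : T -> T) (x : nat -> T).

(** The starting point [x n] varies with the length, since a failure of growth supplies a different
    point for each length; [n.+1] keeps the divisor nonzero. *)
Definition empirical n (A : set T) : R :=
  n.+1%:R^-1 * \sum_(j < n.+1) \1_A (iter j f (x n)).

Lemma empirical_itv n A : 0 <= empirical n A <= 1.
Proof.
rewrite /empirical mulr_ge0 ?invr_ge0 ?sumr_ge0//= ler_pdivrMl ?ltr0Sn// mulr1.
by rewrite -[leRHS]/(n.+1%:R) -[X in _ <= X%:R]card_ord -sumr_const ler_sum.
Qed.

Lemma empiricalT n : empirical n setT = 1.
Proof.
rewrite /empirical (eq_bigr (fun=> 1)); last by move=> i _; rewrite indicE in_setT.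
by rewrite sumr_const card_ord mulVf// pnatr_eq0.
Qed.

Lemma empiricalU n A B : A `&` B = set0 ->
  empirical n (A `|` B) = empirical n A + empirical n B.
Proof.
move=> AB; rewrite /empirical -mulrDr -big_split/=; congr (_ * _).
apply: eq_bigr => j _; rewrite !indicE in_setU.
case: (boolP (_ \in A)) => [xA|_]; last by rewrite add0r.
case: (boolP (_ \in B)) => [xB|_]; last by rewrite addr0.
have : (A `&` B) (iter j f (x n)) by split; exact/set_mem.
by rewrite AB.
Qed.

(** The two sums telescope, leaving a difference of two indicators. *)
Lemma empirical_preimage n A :
  `|empirical n (f @^-1` A) - empirical n A| <= n.+1%:R^-1.
Proof.
rewrite /empirical -mulrBr normrM ger0_norm ?invr_ge0// ler_piMr ?invr_ge0//.
pose a j : R := \1_A (iter j f (x n)).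
rewrite [X in X - _](eq_bigr (fun j : 'I_n.+1 => a j.+1)); last first.
  by move=> j _; rewrite /a !indicE; congr (nat_of_bool _)%:R.
have -> : \sum_(j < n.+1) a j.+1 - \sum_(j < n.+1) a j = a n.+1 - a 0%N.
  by rewrite big_ord_recr big_ord_recl/=; ring.
by rewrite /a !indicE; do 2![case: (_ \in _)];
  rewrite ?subrr ?subr0 ?sub0r ?normrN ?normr1 ?normr0.
Qed.

Variables (U : set_system nat).
Hypotheses (UU : UltraFilter U) (Uoo : \oo `<=` U).

(** By compactness of [0, 1] the image ultrafilter has a cluster point, and an ultrafilter converges
    to its cluster points. *)
Lemma ultra_cvg01 (u : nat -> R) : (forall n, 0 <= u n <= 1) -> cvg (u @ U).
Proof.
move=> u01; have UP := @ultra_proper _ _ UU.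
have u01U : (u @ U) `[0, 1]%classic.
  by apply: (@filterS _ U _ setT _ _ filterT) => n _ /=; rewrite in_itv/=.
have [p [_ cp]] := @segment_compact R 0 1 (u @ U) _ u01U.
apply/cvg_ex; exists p => V Vp.
have [//|UnV] := in_ultra_setVsetC (u @^-1` V) UU.
have [y [nVy Vy]] := cp (~` V) V UnV Vp.
by [].
Qed.

Definition ultra_content (A : set T) : R := lim (empirical n A @[n --> U]).

Lemma ultra_content_cvg A : empirical n A @[n --> U] --> ultra_content A.
Proof. by apply: ultra_cvg01 => n; exact: empirical_itv. Qed.

Lemma ultra_content_ge0 A : 0 <= ultra_content A.
Proof.
have UP := @ultra_proper _ _ UU.
apply: limr_ge; first by apply: ultra_cvg01 => n; exact: empirical_itv.
by apply: nearW => n; case/andP: (empirical_itv n A).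
Qed.

Lemma ultra_contentT : ultra_content setT = 1.
Proof.
have UP := @ultra_proper _ _ UU.
rewrite /ultra_content; under eq_fun do rewrite empiricalT.
exact: lim_cst.
Qed.

Lemma ultra_contentU A B : A `&` B = set0 ->
  ultra_content (A `|` B) = ultra_content A + ultra_content B.
Proof.
move=> AB; have UP := @ultra_proper _ _ UU.
rewrite [LHS]/ultra_content; under eq_fun do rewrite empiricalU//.
apply: cvg_lim; first exact: Rhausdorff.
by apply: cvgD; exact: ultra_content_cvg.
Qed.

Lemma ultra_content_preimage A : ultra_content (f @^-1` A) = ultra_content A.
Proof.
have UP := @ultra_proper _ _ UU; apply: cvg_lim; first exact: Rhausdorff.
have -> : (fun n => empirical n (f @^-1` A)) =
  (fun n => empirical n A + (empirical n (f @^-1` A) - empirical n A)).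
  by apply/funext => n; rewrite addrCA subrr addr0.
rewrite -[ultra_content A]addr0; apply: cvgD; first exact: ultra_content_cvg.
(* [U] refines [\oo], along which the discrepancy, at most [n.+1%:R^-1], tends to 0. *)
apply: (@cvg_trans _ ((empirical n (f @^-1` A) - empirical n A) @[n --> \oo])).
  exact: cvg_app.
apply/cvgr0Pnorm_le => e e0; near=> n.
apply: (le_trans (empirical_preimage n A)).
apply: ltW; near: n; exact: (near_infty_natSinv_lt (PosNum e0)).
Unshelve. all: by end_near. Qed.

End EmpiricalContent.

(** * Invariant probabilities *)

Section BorelIntegral.
Context {R : realType} {K : ptopologicalType}.
Hypothesis cK : compact [set: K].

Lemma continuous_bounds (h : K -> R) : continuous h ->
  exists a b, forall k, a <= h k <= b.
Proof.
move=> ch; have hb (g : K -> R) : continuous g -> exists b, forall k, g k <= b.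
  move=> cg; have [] := @compact_EVT_max K R g setT _ cK.
  - by exists point.
  - exact: continuous_subspaceT.
  by move=> c _ cmax; exists (g c) => k; apply: cmax; rewrite in_setT.
have [b hb1] := hb h ch.
have [a ha] : exists a, forall k, - h k <= a.
  by apply: hb => k; apply: continuousN; exact: ch.
by exists (- a), b => k; rewrite hb1 andbT lerNl.
Qed.

Variable mu : probability (borel_space K) R.

Lemma open_measurable_borel (A : set K) : open A ->
  measurable (A : set (borel_space K)).
Proof. by move=> oA; exact: sub_sigma_algebra. Qed.

Lemma continuous_integrable (h : K -> R) : continuous h ->
  mu.-integrable setT (EFin \o (h : borel_space K -> R)).
Proof.
move=> ch; apply: measurable_bounded_integrable => //.
- by rewrite (le_lt_trans (probability_le1 _ _))// ltry.
- apply: (measurability _ (measurable_realfun.RGenOInfty.measurableE R)).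
  move=> _ [_ [x ->] <-].
  rewrite setTI; apply: open_measurable_borel.
  by apply: open_comp => //; exact: interval_open.
- have [a [b hab]] := continuous_bounds ch.
  exists (Num.max (- a) b); split; first exact: num_real.
  move=> M abM k _ /=; rewrite ler_norml.
  move: abM; rewrite gt_max => /andP[aM bM]; have := hab k; lra.
Qed.

(** The right-hand side is the exact integral of [a + staircase e N (h k - a)], computed by
    induction on the number of steps, and this function dominates [h]. *)
Lemma Rintegral_le_staircase (h : K -> R) a e N : continuous h -> 0 < e ->
  (forall k, h k <= a + N%:R * e) ->
  (\int[mu]_(k in [set: borel_space K]) h k <=
   a + \sum_(i < N) e * fine (mu [set k | (i%:R * e < h k - a)%R])).
Proof.
move=> ch e0 hN.
have mU i : measurable ([set k | (i%:R * e < h k - a)%R] : set (borel_space K)).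
  apply: open_measurable_borel.
  rewrite (_ : [set k | _] = h @^-1` `]a + i%:R * e, +oo[); last first.
    by apply/seteqP; split => k /=; rewrite in_itv/= andbT ltrBrDl.
  by apply: open_comp => //; exact: interval_open.
have muT : fine (mu [set: borel_space K]) = 1 by rewrite probability_setT.
have step n : mu.-integrable setT (EFin \o
     (fun k : borel_space K => a + staircase e n (h k - a))) /\
   \int[mu]_(k in [set: borel_space K]) (a + staircase e n (h k - a)) =
   a + \sum_(i < n) e * fine (mu [set k | (i%:R * e < h k - a)%R]).
  elim: n => [|n [IHi IH]].
    rewrite big_ord0; split; last first.
      under eq_Rintegral do rewrite /staircase big_ord0.
      by rewrite Rintegral_cst// muT mulr1.
    apply: continuous_integrable => k; rewrite /staircase.
    by under eq_fun do rewrite big_ord0; exact: cvg_cst.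
  pose U := [set k : borel_space K | (n%:R * e < h k - a)%R].
  have E k : a + staircase e n.+1 (h k - a) =
      (a + staircase e n (h k - a)) + e * \1_U k.
    rewrite /staircase big_ord_recr/= addrA; congr (_ + _ * (nat_of_bool _)%:R).
    by apply/idP/idP => [?|/set_mem//]; exact/mem_set.
  have iU : mu.-integrable setT (EFin \o (fun k : borel_space K => \1_U k : R)).
    by apply: integrable_indic; exact: mU.
  have ieU : mu.-integrable setT (EFin \o (fun k : borel_space K => e * \1_U k : R)).
    by have := integrableZl (measurableT) e iU.
  have -> : (fun k : borel_space K => a + staircase e n.+1 (h k - a)) =
    (fun k => (a + staircase e n (h k - a)) + e * \1_U k) by exact/funext.
  split.
    by have := integrableD measurableT IHi ieU.
  rewrite RintegralD// IH RintegralZl// big_ord_recr/= addrA; congr (_ + _ * _).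
  by rewrite /Rintegral integral_indic ?setIT//; exact: mU.
have [iN <-] := step N.
apply: le_Rintegral => //; first exact: continuous_integrable.
move=> k _; rewrite -lerBlDl; apply: staircase_ge => //.
by rewrite lerBlDl.
Qed.

End BorelIntegral.

Section InvariantProbability.
Variables (R : realType) (K : ptopologicalType).
Hypotheses (cK : compact [set: K]) (hK : hausdorff_space K).
Variables (f : K -> K) (h : K -> R).
Hypotheses (cf : continuous f) (ch : continuous h).

(** The integral is at most a staircase sum of masses of open superlevel sets, hence of their
    contents; that sum is the limit along [U] of time averages of the staircase of [h], each at most
    [L + e]. *)
Lemma exists_invariant_probability (x : nat -> K) L :
  (forall n, \sum_(j < n.+1) h (iter j f (x n)) <= n.+1%:R * L) ->
  exists2 mu : probability (borel_space K) R, invariant_probabilities f mu &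
    \int[mu]_(k in [set: borel_space K]) h k <= L.
Proof.
move=> xL.
have [U [UU Uoo]] := ultraFilterLemma (eventually_filter).
have UP := @ultra_proper _ _ UU.
pose m : set K -> R := ultra_content R f x U.
have m0 A : 0 <= m A by exact: ultra_content_ge0.
have mT : m setT = 1 by exact: ultra_contentT.
have mU A B : A `&` B = set0 -> m (A `|` B) = m A + m B by exact: ultra_contentU.
have mf A : m (f @^-1` A) = m A by exact: ultra_content_preimage.
have [mu muf mum] := content_regularization cK hK m0 mT mU cf mf.
exists mu => //.
apply/ler_addgt0Pr => e e0.
have [a [b hab]] := continuous_bounds cK ch.
have [N baN] : exists N, b - a <= N%:R * e.
  exists (Num.truncn ((b - a) / e)).+1.
  by rewrite -ler_pdivrMr// ltW// truncnS_gt.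
apply: (le_trans (Rintegral_le_staircase cK _ ch e0 (a := a) (N := N) _)).
  by move=> k; case/andP: (hab k) => _ /le_trans; apply; rewrite -lerBlDl.
pose V i : set K := [set k | (i%:R * e < h k - a)%R].
apply: (@le_trans _ _ (a + \sum_(i < N) e * m (V i))).
  rewrite lerD2l; apply: ler_sum => i _; rewrite ler_pM2l// -lee_fin.
  have oV : open (V i).
    rewrite /V (_ : [set k | _] = h @^-1` `]a + i%:R * e, +oo[); last first.
      by apply/seteqP; split => k /=; rewrite in_itv/= andbT ltrBrDl.
    by apply: open_comp => //; exact: interval_open.
  rewrite fineK ?fin_num_measure//; last exact: open_measurable_borel.
  exact: mum.
have cvgV : a + \sum_(i < N) e * empirical R f x n (V i) @[n --> U] -->
    a + \sum_(i < N) e * m (V i).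
  apply: cvgD; first exact: cvg_cst.
  apply: cvg_big => [|i _]; first exact: add_continuous.
  apply: cvgM; first exact: cvg_cst.
  exact: ultra_content_cvg.
rewrite -(cvg_lim (@Rhausdorff R) cvgV); apply: limr_le.
  by apply/cvg_ex; eexists; exact: cvgV.
apply: nearW => n.
(* Exchanging the sums turns visit frequencies of the superlevel sets into an orbit average. *)
rewrite (_ : \sum_(i < N) _ =
   n.+1%:R^-1 * \sum_(j < n.+1) staircase e N (h (iter j f (x n)) - a)); last first.
  rewrite /empirical.
  under eq_bigr do rewrite mulrCA mulr_sumr.
  rewrite -mulr_sumr exchange_big/=; congr (_ * _); apply: eq_bigr => j _.
  apply: eq_bigr => i _; rewrite indicE; congr (_ * (nat_of_bool _)%:R).
  by apply/idP/idP => [/set_mem//|?]; exact/mem_set.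
have n0 : 0 < n.+1%:R :> R by rewrite ltr0Sn.
rewrite -lerBrDl ler_pdivrMl//.
apply: (@le_trans _ _ (\sum_(j < n.+1) (h (iter j f (x n)) + (e - a)))).
  apply: ler_sum => j _; rewrite addrCA [leRHS]addrC; apply: staircase_le => //.
  by rewrite subr_ge0; case/andP: (hab (iter j f (x n))).
rewrite big_split/= sumr_const card_ord -mulr_natl.
have := xL n; nra.
Qed.

End InvariantProbability.

(** * The range of a weighted composition operator *)

Section FibreSections.
Variables (K : ptopologicalType).
Hypotheses (cK : compact [set: K]) (hK : hausdorff_space K).
Variables (phi : continuousType K K) (s : K -> K).
Hypothesis sK : cancel s phi.

Lemma identified_pairsE p q :
  identified_pairs phi s (p, q) <-> p <> q /\ q = s (phi p).
Proof.
rewrite /identified_pairs/=; split => [[pq e qE]|[pq qE]].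
  by split => //; rewrite e.
by split => //; rewrite qE sK.
Qed.

Lemma compact_closed_map (D : set K) : closed D -> closed (phi @` D).
Proof.
move=> cD; apply: compact_closed => //; apply: continuous_compact.
  by apply: continuous_subspaceT; exact: cts_fun.
exact: subclosed_compact cD cK _.
Qed.

Lemma fibre_constant_continuous (T : topologicalType) (F : K -> T) :
  continuous F -> (forall p, F (s (phi p)) = F p) -> continuous (F \o s).
Proof.
move=> /continuous_closedP cF Fs; apply/continuous_closedP => D cD.
have -> : (F \o s) @^-1` D = phi @` (F @^-1` D).
  apply/seteqP; split => [y Dy|_ [p Dp <-]] /=; last by rewrite Fs.
  by exists (s y).
by apply: compact_closed_map; exact: cF.
Qed.

(** The exceptional set built from the pairs consists of all points in nontrivial fibres.
    Conversely, two distinct points with the same image both belong to any admissible exceptional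
    set, so the pairs lie in its square. *)
Lemma finite_identified_pairsP : finite_set (identified_pairs phi s) <->
  almost_homeomorphism phi.
Proof.
split=> [fP|[_ _ [S [fS [g [[phiS _ gK _] _]]]]]]; last first.
  apply: (sub_finite_set _ (finite_setX fS fS)) => -[p q] [/= pq phipq _].
  have key x y : x <> y -> phi x = phi y -> S x.
    move=> xy phixy; apply: contrapT => nSx; apply: xy.
    have nSy : ~ S y by move=> Sy; apply: (phiS x nSx); exists y.
    by rewrite -(gK x) ?phixy ?gK// inE.
  by split; [exact: key phipq|apply: (key q p) => //; exact: nesym].
pose P := identified_pairs phi s; pose S := P.`1 `|` P.`2.
have sphi p : ~ S p -> s (phi p) = p.
  move=> nS; apply: contrapT => sp; apply: nS; left; exists (s (phi p)).
  by apply/identified_pairsE; split => //; exact: nesym.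
have satS p r : S r -> phi p = phi r -> S p.
  move=> Sr pr; have [//|pt] := pselect (S p).
  have tE : s (phi r) = p by rewrite -pr sphi.
  have [rp|rp] := pselect (r = p); first by rewrite -rp.
  by right; exists r; apply/identified_pairsE.
split; first exact: cts_fun.
  by apply/seteqP; split => // y _; exists (s y).
exists S; split; first rewrite finite_setU.
  by split; [exact: finite_set_fst|exact: finite_set_snd].
exists s; split.
  split => [p nSp [r Sr pr]|y nSy Ssy|p|y _]; last exact: sK.
  - by apply: nSp; apply: satS Sr _.
  - by apply: nSy; exists (s y).
  - by rewrite inE => nSp; exact: sphi.
split; first by apply: continuous_subspaceT; exact: cts_fun.
apply/subspace_continuousP => y nSy V Vsy.
move: Vsy; rewrite nbhsE => -[U [oU Usy] UV].
(* Closedness of [phi] again: off the image of [U]'s complement, every value of [s] lies in [U]. *)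
have : nbhs y (~` (phi @` (~` U))).
  apply: open_nbhs_nbhs; split.
    by apply: closed_openC; apply: compact_closed_map; exact: open_closedC.
  move=> [d nUd dy]; apply: nUd.
  have nSd : ~ S d by move=> Sd; apply: nSy; exists d.
  by rewrite -(sphi d nSd) dy.
apply: filterS => y' nUy' _; apply: UV; apply: contrapT => nU.
by apply: nUy'; exists (s y').
Qed.

End FibreSections.

(** * Codimension of the range by counting identified pairs *)

Section CompositionDefect.
Variables (R : realType) (K : ptopologicalType).
Hypotheses (cK : compact [set: K]) (hK : hausdorff_space K).
Local Notation CK := (cfun R cK).

Lemma cfun_sumE n (f : 'I_n -> CK) k : (\sum_i f i) k = \sum_i f i k.
Proof.
elim: n f => [|n IH] f; first by rewrite !big_ord0.
by rewrite !big_ord_recr/= cfunDE IH.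
Qed.

Lemma cfun_separation (a : K) (Z : set K) : finite_set Z -> ~ Z a ->
  exists f : CK, f a = 1 /\ forall z, Z z -> f z = 0.
Proof.
move=> fZ nZa.
have /accessible_finite_set_closed cl : accessible_space K.
  exact: hausdorff_accessible.
have := (@normal_separatorP R K).1 (compact_normal hK cK) Z [set a] (cl _ fZ)
  (cl _ (finite_set1 a)).
have Za0 : Z `&` [set a] = set0.
  by rewrite -subset0 => z [Zz za]; apply: nZa; rewrite -za.
move=> /(_ Za0)/uniform_separatorP => /(_ R)[f [cf _ f0 f1]].
have cfC : continuous (fun k => (f k)%:C : R[i]).
  move=> k; apply/cvgrPdist_lt => e; case: e => x y.
  (* Positivity in [R[i]] forces the imaginary part of the tolerance to be 0. *)
  rewrite ltcE/= => /andP[/eqP -> x0].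
  have /cvgrPdist_lt/(_ _ x0) := cf k.
  apply: filterS => k' fk.
  by rewrite -rmorphB -[`|_|]/((normc _)%:C) ltcR/= expr0n addr0 sqrtr_sqr.
exists (to_cfun cK cfC); split => [|z Zz].
  by rewrite /to_cfun/= /mkcts/= (f1 (f a) _)//; exists a.
by rewrite /to_cfun/= /mkcts/= (f0 (f z) _)//; exists z.
Qed.

Variables (w : CK) (phi : continuousType K K) (s : K -> K).
Hypotheses (w_neq0 : forall k, w k != 0) (sK : cancel s phi).

Local Notation T0 := (0 \*: idfun \- wcomp w phi : {linear CK -> CK}).

Fact weighted_cts (u : CK) : continuous (fun k => w k * u k).
Proof. by move=> k; apply: continuousM; exact: cfun_cts. Qed.

(** Urysohn separation applies because the first components are pairwise distinct, each determining
    its pair, and none is a second component: a value of [s] is the chosen point of its own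
    fibre. *)
Lemma identified_pairs_dual (X : seq (K * K)) : uniq X ->
  (forall pq, pq \in X -> identified_pairs phi s pq) ->
  exists u : 'I_(size X) -> CK, forall i j,
    u i (tnth (in_tuple X) j).1 = (i == j)%:R /\ u i (tnth (in_tuple X) j).2 = 0.
Proof.
move=> uX XP; pose p j := (tnth (in_tuple X) j).1.
pose q j := (tnth (in_tuple X) j).2.
have pqP j : p j <> q j /\ q j = s (phi (p j)).
  apply/(identified_pairsE sK); rewrite -surjective_pairing.
  by apply: XP; exact: mem_tnth.
have p_inj i j : p i = p j -> i = j.
  move=> pij; have : tnth (in_tuple X) i = tnth (in_tuple X) j.
    rewrite [LHS]surjective_pairing [RHS]surjective_pairing.
    by rewrite -/(p i) -/(p j) -/(q i) -/(q j) (pqP i).2 (pqP j).2 pij.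
  by move=> /((elimT (tuple_uniqP (in_tuple X))) uX).
have pq i j : p i <> q j.
  move=> pij; apply: (pqP i).1.
  by rewrite (pqP i).2 pij (pqP j).2 sK -(pqP j).2.
suff /choice[u Hu] i : exists f : CK, forall j,
    f (p j) = (i == j)%:R /\ f (q j) = 0 by exists u.
have [||f [fp f0]] := @cfun_separation (p i)
    ((p @` [set j | j != i]) `|` range q).
- by rewrite finite_setU; split; apply: finite_image; exact: finite_finset.
- by move=> [[j ji /p_inj/eqP]|[j _ /esym]]; [rewrite (negbTE ji)|exact: pq].
exists f => j; split; last by apply: f0; right; exists j.
have [<-//|ij] := eqVneq i j.
by apply: f0; left; exists j => //=; rewrite eq_sym.
Qed.

(** Divided by [w], an element of the range is constant on fibres; comparing its values at the two
    points of the j-th pair isolates [c j]. *)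
Lemma identified_pairs_free (X : seq (K * K)) : uniq X ->
  (forall pq, pq \in X -> identified_pairs phi s pq) ->
  has_free_mod (range T0) (size X).
Proof.
move=> uX XP; have [u Hu] := identified_pairs_dual uX XP.
exists (fun i => to_cfun cK (@weighted_cts (u i))) => c [g _ Hg] j.
pose p := (tnth (in_tuple X) j).1; pose q := (tnth (in_tuple X) j).2.
have [pq qE] : p <> q /\ q = s (phi p).
  apply/(identified_pairsE sK); rewrite -surjective_pairing.
  by apply: XP; exact: mem_tnth.
have ev k : - (w k * g (phi k)) = \sum_i c i * (w k * u i k).
  have := congr1 (fun f : CK => f k) Hg; rewrite cfun_sumE => <-.
  by change (- (w k * g (phi k)) = 0 * g k - w k * g (phi k)); rewrite mul0r sub0r.
have gq : g (phi q) = 0.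
  have := ev q; rewrite big1 => [/eqP|i _]; last by rewrite (Hu i j).2 !mulr0.
  by rewrite oppr_eq0 mulf_eq0 (negbTE (w_neq0 _)) => /eqP.
have := ev p; rewrite (_ : phi p = phi q); last by rewrite qE sK.
rewrite gq mulr0 oppr0 (bigD1 j)//= (Hu j j).1 eqxx mulr1 big1 ?addr0; last first.
  by move=> i ij; rewrite (Hu i j).1 (negbTE ij) !mulr0.
by move/esym/eqP; rewrite mulf_eq0 (negbTE (w_neq0 _)) orbF => /eqP.
Qed.

(** When [X] lists all pairs, the functions [w k * u i k] span modulo the range. *)
Lemma identified_pairs_card (X : seq (K * K)) n : uniq X ->
  (forall pq, pq \in X <-> identified_pairs phi s pq) ->
  has_free_mod (range T0) n -> (n <= size X)%N.
Proof.
move=> uX XP [v fv]; have [u Hu] := identified_pairs_dual uX (fun pq => (XP pq).1).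
apply: (free_span_card (range_subspace _)
  (u := fun i => to_cfun cK (@weighted_cts (u i))) _ fv) => x.
pose p j := (tnth (in_tuple X) j).1; pose q j := (tnth (in_tuple X) j).2.
(* The jump of [x / w] across the i-th pair; removing all jumps makes the quotient constant on
   fibres, so it factors continuously through [phi]. *)
pose c i := x (p i) / w (p i) - x (q i) / w (q i).
exists c => //.
pose F k := x k / w k - \sum_i c i * u i k.
have cF : continuous F.
  have cs : continuous (fun k => \sum_i c i * u i k).
    rewrite (_ : (fun _ => _) = (\sum_i c i *: u i : CK)); first exact: cfun_cts.
    by apply/funext => z; rewrite cfun_sumE.
  have cq : continuous (fun k => x k / w k).
    move=> k; apply: continuousM; first exact: cfun_cts.
    by apply: continuousV; [exact: w_neq0|exact: cfun_cts].
  exact: (@cfun_cts _ _ _ (to_cfun cK cq - to_cfun cK cs)).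
have Fs z : F (s (phi z)) = F z.
  have [->//|zs] := pselect (s (phi z) = z).
  have : (z, s (phi z)) \in X.
    by apply/XP/(identified_pairsE sK); split => //; exact: nesym.
  move=> /(tnthP (in_tuple X))[j jE].
  have [-> ->] : z = p j /\ s (phi z) = q j by rewrite /p /q -jE.
  rewrite /F [X in _ - X]big1 ?subr0; last by move=> i _; rewrite (Hu i j).2 mulr0.
  rewrite (bigD1 j)//= (Hu j j).1 eqxx mulr1 big1 ?addr0; last first.
    by move=> i ij; rewrite (Hu i j).1 (negbTE ij) mulr0.
  by rewrite /c opprB addrC subrK.
have cG := fibre_constant_continuous cK hK sK cF Fs.
exists (- to_cfun cK cG) => //; apply/cfunP => k.
change (0 * (- F (s k)) - w k * (- F (s (phi k))) =
  x k - (\sum_i c i *: to_cfun cK (@weighted_cts (u i)) : CK) k).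
rewrite Fs mul0r sub0r mulrN opprK cfun_sumE /F mulrBr mulrCA mulfV// mulr1.
congr (_ - _); rewrite mulr_sumr; apply: eq_bigr => i _.
by rewrite mulrCA.
Qed.

Lemma ecodim_identified_pairs :
  ecodim R (range T0) = counting (identified_pairs phi s).
Proof.
rewrite /counting /ecodim; case: asboolP => [fP|iP].
  set X := fset_set _.
  have XP pq : pq \in finmap.enum_fset X <-> identified_pairs phi s pq.
    by rewrite -[in X in _ <-> X](fset_setK fP).
  apply/eqP; rewrite eq_le; apply/andP; split.
    apply: ge_ereal_sup => _ [n Pn <-]; rewrite lee_fin ler_nat.
    exact: (identified_pairs_card (finmap.fset_uniq X) XP Pn).
  apply: ereal_sup_ubound; exists (size (finmap.enum_fset X)) => //.
  by apply: identified_pairs_free (finmap.fset_uniq X) _ => pq /XP.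
(* With infinitely many pairs, finite subfamilies of any size give independent families, so the
   supremum is infinite. *)
apply/eqP; rewrite -leye_eq leNgt; apply/negP => lty.
set S := ereal_sup _ in lty.
have [r Sr] : exists r : nat, (S < r%:R%:E)%E.
  case: S lty => [x _| |_]; [|by rewrite ltxx|by exists 0; rewrite ltNyr].
  by exists (Num.truncn x).+1; rewrite lte_fin truncnS_gt.
have [X XP rX] := infinite_set_fset r iP.
have := identified_pairs_free (finmap.fset_uniq X) XP.
move=> PX; have : ((size (finmap.enum_fset X))%:R%:E <= S)%E.
  by apply: ereal_sup_ubound; exists (size (finmap.enum_fset X)).
move=> /le_lt_trans/(_ Sr); rewrite lte_fin ltr_nat ltnNge.
by rewrite rX.
Qed.

End CompositionDefect.

(** * Lower bounds for the pencil *)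

Section SupNorm.
Variables (R : realType) (K : ptopologicalType) (cK : compact [set: K]).
Local Notation CK := (cfun R cK).

Lemma supnormD (f g : CK) : supnorm (f + g) <= supnorm f + supnorm g.
Proof. by have := cfun_normD f g; rewrite /cfun_norm -rmorphD lecR. Qed.

Lemma supnormZ a (f : CK) : supnorm (a *: f) = normc a * supnorm f.
Proof.
have := cfun_normZ a f; rewrite /cfun_norm -[`|a|]/((normc a)%:C) -rmorphM.
by move/complexI.
Qed.

Lemma supnorm_eq0 (f : CK) : supnorm f = 0 -> f = 0.
Proof. by move=> f0; apply: cfun_norm0_eq0; rewrite /cfun_norm f0. Qed.

Lemma continuous_normcP (T : topologicalType) (f : T -> R[i]) :
  continuous f <-> forall k e, 0 < e -> \forall k' \near k, normc (f k - f k') < e.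
Proof.
split=> [cf k e e0|H k].
  have e0' : 0 < e%:C :> R[i] by rewrite ltcR.
  have /cvgrPdist_lt/(_ _ e0') := cf k.
  by apply: filterS => k' /=; rewrite -[`|_|]/((normc _)%:C) ltcR.
apply/cvgrPdist_lt => e; case: e => a b.
rewrite ltcE /= => /andP[/eqP -> a0].
by apply: filterS (H k a a0) => k' ?; rewrite -[`|_|]/((normc _)%:C) ltcR.
Qed.

Lemma supnorm_complete : seq_complete (@supnorm R K cK).
Proof.
move=> u cu.
have /choice[g Hg] k : exists l : R[i], forall e, 0 < e ->
    exists n, forall i, (n <= i)%N -> normc (u i k - l) <= e.
  apply: seq_complete_complex => e /cu[n Hn]; exists n => i j ni nj.
  exact: le_trans (normc_le_supnorm (u i - u j) k) (Hn i j ni nj).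
have ug e : 0 < e -> exists n, forall i, (n <= i)%N ->
    forall k, normc (u i k - g k) <= e.
  move=> e0; have [n Hn] := cu e e0; exists n => i ni k.
  apply/ler_addgt0Pr => d d0; have [m Hm] := Hg k d d0.
  pose j := maxn n m.
  rewrite -(subrKA (u j k)) (le_trans (normcD_le _ _))// lerD//.
    apply: le_trans (normc_le_supnorm (u i - u j) k) (Hn i j ni _).
    by rewrite leq_maxl.
  by apply: Hm; rewrite leq_maxr.
have cg : continuous g.
  apply/continuous_normcP => k e e0.
  have e30 : 0 < e / 3 by rewrite divr_gt0.
  have [n Hn] := ug _ e30.
  have /continuous_normcP/(_ k _ e30) := @cfun_cts _ _ _ (u n).
  apply: filterS => k' Hk'.
  rewrite -(subrKA (u n k)) -(subrKA (u n k') (u n k)).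
  have H1 := Hn n (leqnn n) k'; have H2 := Hn n (leqnn n) k.
  rewrite -normc_opp opprB in H2.
  have := normcD_le (g k - u n k) (u n k - u n k' + (u n k' - g k')).
  have := normcD_le (u n k - u n k') (u n k' - g k').
  lra.
exists (to_cfun cK cg) => e e0; have [n Hn] := ug e e0.
by exists n => i ni; apply: supnorm_le => k; exact: Hn.
Qed.

Lemma supnorm_ge0 (f : CK) : 0 <= supnorm f.
Proof. exact: le_trans (normc_ge0 _) (normc_le_supnorm f point). Qed.

Variables (w : CK) (phi : continuousType K K).
Local Notation T := (wcomp w phi).

Lemma supnorm_wcomp_le f : supnorm (T f) <= supnorm w * supnorm f.
Proof. by have := wcomp_norm_le w phi f; rewrite !cfun_normE -rmorphM lecR. Qed.

Lemma supnorm_iter_wcomp_le n f :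
  supnorm (iter n T f) <= supnorm w ^+ n * supnorm f.
Proof.
elim: n => [|n IH]; first by rewrite expr0 mul1r.
rewrite iterS exprS -mulrA (le_trans (supnorm_wcomp_le _))//.
by rewrite ler_wpM2l// supnorm_ge0.
Qed.

Lemma iter_wcomp_linear n a f g :
  iter n T (a *: f + g) = a *: iter n T f + iter n T g.
Proof. by elim: n => //= n ->; rewrite linearP. Qed.

Lemma iter_wcompE n f k :
  iter n T f k = (\prod_(j < n) w (iter j phi k)) * f (iter n phi k).
Proof.
elim: n k => [|n IH] k; first by rewrite big_ord0 mul1r.
rewrite iterS wcompE IH big_ord_recl mulrA -iterSr; congr (_ * _ * _).
by apply: eq_bigr => j _; rewrite -iterSr.
Qed.

(** Induction by writing [T f] as [mu *: f - g], with [g] the pencil at [f]. The constant [M]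
    depends on [n] and [l] only, which makes the final lower bound uniform in [mu]. *)
Lemma iter_wcomp_pencil_le n l : exists2 M, 0 <= M & forall mu f, normc mu <= l ->
  supnorm (iter n T f) <= l ^+ n * supnorm f + M * supnorm (mu *: f - T f).
Proof.
elim: n => [|n [M M0 HM]].
  by exists 0 => // mu f _; rewrite expr0 mul1r mul0r addr0.
exists (`|l| * M + supnorm w ^+ n) => [|mu f mul].
  by rewrite addr_ge0 ?mulr_ge0 ?exprn_ge0 ?supnorm_ge0.
have l0 : 0 <= l := le_trans (normc_ge0 mu) mul.
set g := mu *: f - T f.
have Tf : T f = mu *: f + - g by rewrite opprB addrCA subrr addr0.
rewrite iterSr Tf iter_wcomp_linear (le_trans (supnormD _ _))//.
rewrite ger0_norm// [leRHS](_ : _ = l * (l ^+ n * supnorm f + M * supnorm g) +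
   supnorm w ^+ n * supnorm g); last by rewrite exprS; ring.
apply: lerD.
  rewrite supnormZ; apply: ler_pM; rewrite ?normc_ge0 ?supnorm_ge0//.
  exact: HM.
by rewrite (le_trans (supnorm_iter_wcomp_le _ _))// (seminormN supnormZ).
Qed.

(** Let [d] be the minimum over [K] of the products. As [phi] is onto, the n-th iterate of [T] is
    bounded below by [d]; comparison with the upper bound of [iter_wcomp_pencil_le] leaves the
    margin [d - l ^+ n]. *)
Lemma wcomp_pencil_bounded_below l n : range phi = [set: K] -> 0 <= l ->
  (forall k, l ^+ n < \prod_(j < n) normc (w (iter j phi k))) ->
  exists2 c, 0 < c & forall mu, normc mu <= l -> forall f,
    c * supnorm f <= supnorm (mu *: f - T f).
Proof.
move=> phi_onto l0 ln.
have prodE k : \prod_(j < n) normc (w (iter j phi k)) =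
    normc (\prod_(j < n) w (iter j phi k)).
  by elim/big_ind2 : _ => [|x y x' y' -> ->|]; rewrite ?Normc.normc1 ?Normc.normcM.
have iter_cts j : continuous (iter j phi).
  elim: j => [|j IH] k; first exact: cvg_id.
  by apply: continuous_comp; [exact: IH|exact: cts_fun].
have [d ld dP] : exists2 d, l ^+ n < d &
    forall k, d <= \prod_(j < n) normc (w (iter j phi k)).
  have [] := @compact_EVT_min K R
    (fun k => \prod_(j < n) normc (w (iter j phi k))) setT _ cK.
  - by exists point.
  - apply: continuous_subspaceT => k.
    apply: cvg_big => [|j _]; first exact: mul_continuous.
    apply: (@continuous_comp _ _ _ (fun k => w (iter j phi k))).
      by apply: continuous_comp; [exact: iter_cts|exact: cfun_cts].
    exact: normc_cts.
  move=> c _ cmin; exists (\prod_(j < n) normc (w (iter j phi c))) => // k.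
  by apply: cmin; rewrite in_setT.
have iter_onto j k : exists k', iter j phi k' = k.
  elim: j k => [|j IH] k; first by exists k.
  have [k1 <-] := IH k; have : range phi k1 by rewrite phi_onto.
  by case=> k2 _ <-; exists k2; rewrite iterSr.
have Tn f : d * supnorm f <= supnorm (iter n T f).
  have d0 : 0 < d by apply: le_lt_trans ld; rewrite exprn_ge0.
  rewrite -ler_pdivlMl//; apply: supnorm_le => k; rewrite ler_pdivlMl//.
  have [k' <-] := iter_onto n k.
  apply: le_trans (normc_le_supnorm _ k').
  by rewrite iter_wcompE Normc.normcM -prodE ler_wpM2r ?normc_ge0.
have [M M0 HM] := iter_wcomp_pencil_le n l.
have M1 : 0 < M + 1 by rewrite ltr_wpDl.
exists ((d - l ^+ n) / (M + 1)) => [|mu mul f]; first by rewrite divr_gt0 ?subr_gt0.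
rewrite mulrAC ler_pdivrMr// mulrBl lerBlDl.
apply: (le_trans (Tn f)); apply: (le_trans (HM mu f mul)).
by rewrite lerD2l mulrC ler_wpM2l ?supnorm_ge0// lerDl.
Qed.

End SupNorm.

(** * Growth of the weight products below [rho_min] *)

Section RhoMin.
Variables (R : realType) (K : ptopologicalType).
Hypotheses (cK : compact [set: K]) (hK : hausdorff_space K).
Variables (w : cfun R cK) (phi : continuousType K K).
Hypothesis w_neq0 : forall k, 0 < normc (w k).

Let h k := ln (normc (w k)).

Let h_cts : continuous h.
Proof.
move=> k; have nk : {for k, continuous (fun k => normc (w k))}.
  by apply: continuous_comp; [exact: cfun_cts|exact: normc_cts].
exact: (continuous_comp nk (continuous_ln (w_neq0 k))).
Qed.

Lemma rho_min_le mu : invariant_probabilities phi mu ->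
  rho_min w phi <= expR (\int[mu]_(k in [set: borel_space K]) h k).
Proof.
move=> muphi; apply: ge_inf; last by exists mu.
by exists 0 => _ [nu _ <-]; exact: expR_ge0.
Qed.

(** An invariant probability must be exhibited, because [inf] of the empty set is 0 by default; then
    the exponential of a lower bound of [h] bounds the infimum from below. *)
Lemma rho_min_gt0 : 0 < rho_min w phi.
Proof.
have [a [b hab]] := continuous_bounds cK h_cts.
have [|mu muphi _] := @exists_invariant_probability R K cK hK phi h cts_fun h_cts
    (fun=> point) b.
  move=> n; rewrite mulr_natl -[X in _ *+ X]card_ord -sumr_const ler_sum// => i _.
  by case/andP: (hab (iter i phi point)).
apply: (lt_le_trans (expR_gt0 a)); apply: lb_le_inf; first by eexists; exists mu.
move=> _ [nu _ <-]; rewrite ler_expR.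
have <- : \int[nu]_(k in [set: borel_space K]) a = a.
  rewrite Rintegral_cst// -[RHS]mulr1; congr (_ * _).
  exact: (congr1 fine (probability_setT nu)).
apply: le_Rintegral => //.
- by apply: continuous_integrable => // k; exact: cvg_cst.
- exact: continuous_integrable.
- by move=> k _; case/andP: (hab k).
Qed.

(** Otherwise each length has a starting point whose logarithmic orbit sum is at most the length
    times [ln l], and the resulting invariant probability yields [rho_min w phi <= l]. *)
Lemma rho_min_growth l : 0 <= l < rho_min w phi -> exists n,
  forall k, l ^+ n < \prod_(j < n) normc (w (iter j phi k)).
Proof.
move=> /andP[]; rewrite le_eqVlt => /predU1P[<- _|l0 lrho].
  (* The case [l = 0] is separate, since [ln] has a default value at 0; one factor is enough. *)
  by exists 1 => k; rewrite expr1 big_ord_recl big_ord0 mulr1.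
apply: contrapT => H; move: lrho; apply/negP; rewrite -leNgt.
have /choice[x Hx] n : exists k,
    \prod_(j < n.+1) normc (w (iter j phi k)) <= l ^+ n.+1.
  apply: contrapT => H2; apply: H; exists n.+1 => k; rewrite ltNge.
  by apply/negP => H3; apply: H2; exists k.
have [|mu muphi muh] := @exists_invariant_probability R K cK hK phi h cts_fun h_cts
    x (ln l).
  move=> n; rewrite mulr_natl -lnXn//.
  have -> : \sum_(j < n.+1) h (iter j phi (x n)) =
      ln (\prod_(j < n.+1) normc (w (iter j phi (x n)))).
    elim: n.+1 => [|m IH]; first by rewrite !big_ord0 ln1.
    rewrite !big_ord_recr/= IH lnM// posrE; last exact: w_neq0.
    by apply: prodr_gt0.
  by rewrite ler_ln ?posrE ?exprn_gt0//; apply: prodr_gt0.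
by rewrite (le_trans (rho_min_le muphi))// -[leRHS]lnK ?posrE// ler_expR.
Qed.

End RhoMin.

(** * Fredholm properties of the pencil *)

Section SubspaceDimension.
Variables (R : realType) (F : numFieldType) (V : lmodType F).

Lemma edim_set0 : edim R [set (0 : V)] = 0%E.
Proof.
rewrite /edim -[RHS](ereal_sup1 0%E); congr ereal_sup; apply/seteqP; split.
  move=> _ [[|n] [v [v0 fv]] <-]//.
  have := fv (fun=> 1) _ ord0; rewrite big1 => [/(_ erefl)/eqP|i _].
    by rewrite oner_eq0.
  by rewrite v0 scaler0.
by move=> _ ->; exists 0 => //; exists (fun=> 0); split => [[]//|c _ []].
Qed.

End SubspaceDimension.

Lemma supnorm_closed (R : realType) (K : ptopologicalType)
    (cK : compact [set: K]) (U : set (cfun R cK)) :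
  norm_closed (@supnorm R K cK) U -> closed U.
Proof.
move=> cU x clx; apply: cU => e e0.
have e0' : 0 < e%:C :> R[i] by rewrite ltcR.
have [y [Uy]] := clx _ (nbhsx_ballx x _ e0').
rewrite -ball_normE /ball_/= cfun_normE ltcR => xy.
by exists y => //; exact: ltW.
Qed.

Section PencilOnCfun.
Variables (R : realType) (K : ptopologicalType).
Hypotheses (cK : compact [set: K]) (hK : hausdorff_space K).
Variables (phi : continuousType K K) (w : cfun R cK).
Hypotheses (phi_onto : range phi = [set: K]) (w_gt0 : forall k, 0 < normc (w k)).
Local Notation CK := (cfun R cK).
Local Notation pencil mu := (mu \*: idfun \- wcomp w phi : {linear CK -> CK}).

Lemma pencil_lower_bound mu : normc mu < rho_min w phi ->
  exists2 c, 0 < c & forall nu, normc nu <= normc mu -> forall f,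
    c * supnorm f <= supnorm (nu *: f - wcomp w phi f).
Proof.
move=> mur; have [|n Hn] := @rho_min_growth R K cK hK w phi w_gt0 (normc mu).
  by rewrite normc_ge0.
by apply: wcomp_pencil_bounded_below Hn => //; exact: normc_ge0.
Qed.

Lemma pencil_nullity mu : normc mu < rho_min w phi -> nullity R (pencil mu) = 0%E.
Proof.
move=> /pencil_lower_bound[c c0 Hc].
rewrite /nullity (_ : null_space _ = [set 0]) ?edim_set0//.
apply/seteqP; split => [f /= Tf|_ -> /=]; last exact: linear0.
apply: supnorm_eq0; apply/eqP; rewrite eq_le supnorm_ge0 andbT.
rewrite -(pmulr_rle0 _ c0); apply: le_trans (Hc mu (lexx _) f) _.
change (supnorm (pencil mu f) <= 0).
by rewrite Tf (seminorm0 (@supnormZ R K cK)).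
Qed.

Lemma pencil_range_closed_cfun mu : normc mu < rho_min w phi ->
  closed (range (pencil mu)).
Proof.
move=> /pencil_lower_bound[c c0 Hc]; apply: supnorm_closed.
exact: (pencil_range_closed (@supnormD R K cK) (@supnormZ R K cK)
  (@supnorm_eq0 R K cK) (@supnorm_complete R K cK)
  (@supnorm_wcomp_le R K cK w phi) c0 Hc (lexx _)).
Qed.

(** For each length, independent families modulo the range exist at [mu] exactly when they exist at
    0, so both codimensions are suprema of the same set. *)
Lemma pencil_defect mu (s : K -> K) : normc mu < rho_min w phi -> cancel s phi ->
  defect R (pencil mu) = counting (identified_pairs phi s).
Proof.
move=> /pencil_lower_bound[c c0 Hc] sK.
have w_neq0 k : w k != 0.
  by apply: contraTneq (w_gt0 k) => ->; rewrite Normc.normc0 ltxx.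
rewrite -(@ecodim_identified_pairs R K cK hK w phi s w_neq0 sK) /defect /ecodim.
congr ereal_sup; congr image; apply/seteqP; split => n;
  by move/(has_free_mod_pencil (@supnormD R K cK) (@supnormZ R K cK)
  (@supnorm_eq0 R K cK) (@supnorm_complete R K cK)
  (@supnorm_wcomp_le R K cK w phi) c0 Hc n (lexx _)).
Qed.

End PencilOnCfun.

Theorem theorem3p3 (R : realType) (K : ptopologicalType)
    (cK : compact [set: K]) (hK : hausdorff_space K)
    (phi : continuousType K K) (phi_onto : range phi = [set: K])
    (phi_noninv : ~ homeomorphism_on [set: K] [set: K] phi)
    (w : cfun R cK) (w_neq0 : forall k : K, 0 < `|w k|) :
  let A (lambda : R[i]) : {linear cfun R cK -> cfun R cK} :=
    lambda \*: idfun \- wcomp w phi in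
  let rho : R := rho_min w phi in
  [/\ (forall lambda, `|lambda| < rho%:C -> lower_semi_fredholm R (A lambda)) <->
      (forall lambda, `|lambda| < rho%:C -> fredholm R (A lambda)),
      (forall lambda, `|lambda| < rho%:C -> fredholm R (A lambda)) <->
      almost_homeomorphism phi &
      forall lambda, `|lambda| < rho%:C ->
        fredholm_index R (A lambda) = defect R (A lambda) /\
        forall s : K -> K, cancel s phi ->
          defect R (A lambda) = counting (identified_pairs phi s)].
Proof.
move=> A rho.
have w_gt0 k : 0 < normc (w k).
  by have := w_neq0 k; rewrite -[`|_|]/((normc _)%:C) ltcR.
have small mu : `|mu| < rho%:C -> normc mu < rho.
  by rewrite -[`|_|]/((normc _)%:C) ltcR.
have null mu : `|mu| < rho%:C -> nullity R (A mu) = 0%E.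
  by move=> /small; exact: pencil_nullity.
have upper mu : `|mu| < rho%:C -> upper_semi_fredholm R (A mu).
  move=> mur; split; first exact: pencil_range_closed_cfun (small _ mur).
  by rewrite null// ltry.
have /choice[s sK] (y : K) : exists x, phi x = y.
  by have [x _ <-] : range phi y by [rewrite phi_onto]; exists x.
have defE mu : `|mu| < rho%:C -> forall s : K -> K, cancel s phi ->
    defect R (A mu) = counting (identified_pairs phi s).
  by move=> /small mur t tK; exact: pencil_defect.
have lsfP mu : `|mu| < rho%:C ->
    (lower_semi_fredholm R (A mu) <-> almost_homeomorphism phi).
  move=> mur; rewrite -(finite_identified_pairsP cK hK sK) /lower_semi_fredholm.
  by rewrite (defE mu mur s sK) /counting; case: asboolP => //; rewrite ltry.
(* The disc contains 0, so the conditions quantified over it are not vacuous and yield information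
   on [phi]. *)
have r0 : `|0 : R[i]| < rho%:C.
  by rewrite normr0 ltcR; exact: rho_min_gt0.
split.
- split=> H mu mur; last by case: (H mu mur).
  by split; [exact: H|exact: upper].
- split=> [/(_ 0 r0)[/(lsfP 0 r0)]//|aphi mu mur].
  by split; [exact/(lsfP mu mur)|exact: upper].
- move=> mu mur; split; last exact: defE.
  by rewrite /fredholm_index null// sube0.
Qed.
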